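(* Let $(\varepsilon^{(k)})_{k\in\mathbb N}$ be a sequence of positive numbers with $\varepsilon^{(k)}\to0$ as $k\to\infty$. Let $\{(\rho^{(k)},\boldsymbol u^{(k)})\}_{k}$ be the corresponding sequence of numerical solutions obtained from the scheme (S1)--(S2) recalled in the context (with $\varepsilon=\varepsilon^{(k)}$, on a fixed space-time discretisation) with respect to a sequence of well-prepared initial data $\{(\rho_0^{(k)},\boldsymbol u_0^{(k)})\}_k\subset L^\infty(\Omega)^{1+d}$. Then $\{\rho^{(k)}\}_k$ converges to $\tilde\rho\in L_{\mathcal M}(\Omega)$ in $L^\infty(0,T;L^r(\Omega))$ for any $r\in(1,\min\{2,\gamma\}]$, and so in any discrete norm on $L_{\mathcal M}(\Omega)$. Furthermore, there exists $(\pi,\boldsymbol U)\in L^\infty(0,T;L_{\mathcal M}(\Omega)\times\boldsymbol H_{\mathcal E,0}(\Omega))$ such that $\{\boldsymbol u^{(k)}\}_k$ converges to $\boldsymbol U\in L^\infty(0,T;\boldsymbol H_{\mathcal E,0}(\Omega))$ in any discrete norm as $k\to\infty$, and the piecewise constant (in time) function given by $\{(\pi^n,\boldsymbol U^n)\}_{1\le n\le N}\subset L_{\mathcal M}(\Omega)\times\boldsymbol H_{\mathcal E,0}(\Omega)$ is defined as follows: given $(\pi^n,\boldsymbol U^n)\in L_{\mathcal M}(\Omega)\times\boldsymbol H_{\mathcal E,0}(\Omega)$ at time $t^n$ (where $\boldsymbol U^0$ is the limit of the discretised initial velocities), $(\pi^{n+1},\boldsymbol U^{n+1})\in L_{\mathcal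 M}(\Omega)\times\boldsymbol H_{\mathcal E,0}(\Omega)$ solves the semi-implicit scheme $$\big(\mathrm{div}_{\mathcal M}(\tilde\rho(\boldsymbol U^n-\delta\boldsymbol U^{n+1}))\big)_K=0\quad\forall K\in\mathcal M,$$ $$\frac1{\delta t}\tilde\rho_{D_\sigma}(U^{n+1}_\sigma-U^n_\sigma)+\frac1{|D_\sigma|}\sum_{\epsilon\in\tilde{\mathcal E}(D_\sigma)}F_{\epsilon,\sigma}(\tilde\rho,\boldsymbol U^n-\delta\boldsymbol U^{n+1})\,U^n_{\epsilon,\rm up}+\tilde\rho_\sigma(\partial^{(i)}_{\mathcal E}\pi^{n+1})_\sigma=0\quad\forall\sigma\in\mathcal E^{(i)}_{\rm int},\ 1\le i\le d,$$ with the correction term $(\delta U^{n+1})_\sigma=\eta\,\delta t\,(\partial^{(i)}_{\mathcal E}\pi^{n+1})_\sigma$, $\eta>\frac1{\tilde\rho_{D_\sigma}}$, for $\sigma\in\mathcal E^{(i)}_{\rm int}$, $i=1,\dots,d$ (here $\eta$ is the limit as $k\to\infty$ of the stabilisation parameter at $\sigma$).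
   Context: Data. $d\in\{1,2,3\}$, $T>0$, $\gamma>1$, $\varepsilon\in(0,1]$; $\Omega\subset\mathbb R^d$ is a bounded open connected set whose closure is a finite union of closed axis-parallel intervals/rectangles/parallelepipeds. $\wp(\rho)=\rho^\gamma$ and $h_\gamma(\rho)=\rho^\gamma/(\gamma-1)$ for $\rho>0$. $\phi$ is a given smooth potential, and the hydrostatic density is $\tilde\rho(x)=\big(\frac{\gamma-1}{\gamma}(C(m_0)-\phi(x))\big)^{1/(\gamma-1)}$ (so $h_\gamma'(\tilde\rho)+\phi=C(m_0)$), where the constant $C(m_0)$ is determined by the total mass $m_0$; it is assumed bounded below by a positive constant on $\Omega$. Well-prepared data. A family $(\rho_0^\varepsilon,\boldsymbol u_0^\varepsilon)\in L^\infty(\Omega)^{1+d}$ is well-prepared if $\rho_0^\varepsilon>0$ a.e.; $\rho_0^\varepsilon=\tilde\rho+\varepsilon r_0^\varepsilon$ with $\{r_0^\varepsilon\}$ bounded in $L^\infty(\Omega)$ and $r_0^\varepsilon\to0$ in $L^2(\Omega)$ as $\varepsilon\to0$; and $\boldsymbol u_0^\varepsilon\to\boldsymbol U_0$ in $L^2(\Omega)^d$ as $\varepsilon\to0$ with $\mathrm{div}(\tilde\rho\boldsymbol U_0)=0$ (analogously for a sequence $\varepsilon^{(k)}\to0$). Mesh. A MAC grid $\mathcal T=(\mathcal M,\mathcal E)$ consists of a partition $\mathcal M$ of $\bar\Omega$ into closed axis-parallel cells (conforming, possibly non-uniform) and the set $\mathcal E=\bigcup_{i=1}^d\mathcal E^{(i)}$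 of their faces, $\mathcal E^{(i)}=\mathcal E^{(i)}_{\rm int}\cup\mathcal E^{(i)}_{\rm ext}$ being the (internal and external) faces orthogonal to the $i$-th canonical vector $e^{(i)}$. $\mathcal E(K)$ is the set of faces of $K$; $\sigma=K|L$ is the internal face common to $K,L$; $\boldsymbol\nu_{\sigma,K}$ is the unit normal to $\sigma$ outward to $K$. For $\sigma=K|L$ the dual cell is $D_\sigma=D_{\sigma,K}\cup D_{\sigma,L}$, with $D_{\sigma,K}$ the half of $K$ adjacent to $\sigma$ (for external $\sigma\in\mathcal E(K)$, $D_\sigma=D_{\sigma,K}$); $\tilde{\mathcal E}(D_\sigma)$ is the set of faces of $D_\sigma$, and $\epsilon=D_\sigma|D_{\sigma'}$ denotes a common dual face. $L_{\mathcal M}(\Omega)$: functions constant on each $K\in\mathcal M$; $\mathcal X_K$ is the characteristic function of $K$. $\boldsymbol H_{\mathcal E,0}(\Omega)$: vector fields $\boldsymbol u$ whose $i$-th component is constant ($=u_\sigma$) on each $D_\sigma$, $\sigma\in\mathcal E^{(i)}$, and zero for $\sigma\in\mathcal E^{(i)}_{\rm ext}$. For $q\in L_{\mathcal M}(\Omega)$, $\sigma=K|L$: $|D_\sigma|q_{D_\sigma}=|D_{\sigma,K}|q_K+|D_{\sigma,L}|q_L$. Interface values and discrete operators. For a positive $\rho\in L_{\mathcal M}(\Omega)$ and $\sigma=K|L$, $\rho_\sigma$ is the unique number between $\rho_K$ and $\rho_L$ with $\rho_K^\gamma-\rho_L^\gamma=\rho_\sigma(h_\gamma'(\rho_K)-h_\gamma'(\rho_L))$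 if $\rho_K\ne\rho_L$, and $\rho_\sigma=\rho_K$ if $\rho_K=\rho_L$. For $\sigma=K|L\in\mathcal E^{(i)}_{\rm int}$, $(\partial^{(i)}_{\mathcal E}q)_\sigma=\frac{|\sigma|}{|D_\sigma|}(q_L-q_K)\,e^{(i)}\cdot\boldsymbol\nu_{\sigma,K}$. For $\boldsymbol v\in\boldsymbol H_{\mathcal E,0}(\Omega)$, $v_{\sigma,K}=v_\sigma e^{(i)}\cdot\boldsymbol\nu_{\sigma,K}$ and $(\mathrm{div}_{\mathcal M}(\rho\boldsymbol v))_K=\frac1{|K|}\sum_{\sigma\in\mathcal E(K)}|\sigma|\rho_\sigma v_{\sigma,K}$. Discrete hydrostatic data: $\tilde\rho=\sum_K\tilde\rho_K\mathcal X_K$ with $\tilde\rho_K=\frac1{|K|}\int_K\tilde\rho(x)\,dx$, $\phi_K=C(m_0)-h_\gamma'(\tilde\rho_K)$. Fluxes. For positive $\rho\in L_{\mathcal M}(\Omega)$ and advecting field $\boldsymbol v\in\boldsymbol H_{\mathcal E,0}(\Omega)$ put $F_{\sigma,K}=|\sigma|\rho_\sigma v_{\sigma,K}$ for internal $\sigma$, zero on external faces. Dual fluxes $F_{\epsilon,\sigma}$ ($\sigma=K|L\in\mathcal E^{(i)}_{\rm int}$, $\epsilon\in\tilde{\mathcal E}(D_\sigma)$): zero if $\epsilon\subset\partial\Omega$; if $\epsilon\perp e^{(i)}$ lies in $K$, $F_{\epsilon,\sigma}=\frac12(F_{\sigma',K}-F_{\sigma,K})$ with $\sigma'$ the face of $K$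 opposite to $\sigma$; otherwise $\epsilon$ consists of halves of faces $\tau\in\mathcal E(K)$, $\tau'\in\mathcal E(L)$ and $F_{\epsilon,\sigma}=\frac12(F_{\tau,K}+F_{\tau',L})$. In (S1)--(S2), $F_{\cdot,\cdot}(\rho^{n+1},\boldsymbol u^n)$ is computed with density $\rho^{n+1}$ and advecting field $\boldsymbol u^n-\delta\boldsymbol u^{n+1}$, where, with $p^{n+1}_K=(\rho^{n+1}_K)^\gamma$, $\delta u^{n+1}_\sigma=\frac{\eta\,\delta t}{\varepsilon^2}\big[(\partial^{(i)}_{\mathcal E}p^{n+1})_\sigma+\rho^{n+1}_\sigma(\partial^{(i)}_{\mathcal E}\phi)_\sigma\big]$ for $\sigma\in\mathcal E^{(i)}_{\rm int}$, zero on external faces; in the limit scheme $F_{\epsilon,\sigma}(\tilde\rho,\boldsymbol U^n-\delta\boldsymbol U^{n+1})$ is computed with density $\tilde\rho$ and advecting field $\boldsymbol U^n-\delta\boldsymbol U^{n+1}$ ($\delta U^{n+1}_\sigma=0$ on external faces). For $\epsilon=D_\sigma|D_{\sigma'}$, $v_{\epsilon,\rm up}=v_\sigma$ if $F_{\epsilon,\sigma}\ge0$ and $v_{\sigma'}$ otherwise. Scheme. $\delta t>0$, $t^n=n\delta t$, $t^N=T$. For $0\le n\le N-1$, $(\rho^{n+1},\boldsymbol u^{n+1})\in L_{\mathcal M}(\Omega)\times\boldsymbol H_{\mathcal E,0}(\Omega)$, $\rho^{n+1}>0$, satisfies (S1) $\frac1{\delta t}(\rho^{n+1}_K-\rho^n_K)+\frac1{|K|}\sum_{\sigma\in\mathcal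 E(K)}F_{\sigma,K}(\rho^{n+1},\boldsymbol u^n)=0$ for all $K\in\mathcal M$; (S2) $\frac1{\delta t}(\rho^{n+1}_{D_\sigma}u^{n+1}_\sigma-\rho^n_{D_\sigma}u^n_\sigma)+\frac1{|D_\sigma|}\sum_{\epsilon\in\tilde{\mathcal E}(D_\sigma)}F_{\epsilon,\sigma}(\rho^{n+1},\boldsymbol u^n)u^n_{\epsilon,\rm up}+\frac1{\varepsilon^2}(\partial^{(i)}_{\mathcal E}p^{n+1})_\sigma=-\frac1{\varepsilon^2}\rho^{n+1}_\sigma(\partial^{(i)}_{\mathcal E}\phi)_\sigma$ for all $\sigma\in\mathcal E^{(i)}_{\rm int}$, $1\le i\le d$; with $\rho^0_K=\frac1{|K|}\int_K\rho_0^\varepsilon\,dx$, $u^0_\sigma=\frac1{|D_\sigma|}\int_{D_\sigma}u_0^{\varepsilon,(i)}\,dx$ ($\sigma\in\mathcal E^{(i)}_{\rm int}$). Discrete solutions are identified with functions of time equal to the level-$(n+1)$ value on $(t^n,t^{n+1}]$. Standing stability conditions (for every $\varepsilon$, $0\le n\le N-1$, $\sigma\in\mathcal E^{(i)}_{\rm int}$; $x^-=\frac12(|x|-x)$): $\eta=\eta_1/\rho^n_{D_\sigma}$ at the interface $\sigma$, with a fixed constant $\eta_1>3/2$; $\frac{\delta t}{|D_\sigma|}\sum_{\epsilon\in\tilde{\mathcal E}(D_\sigma)}\frac{F_{\epsilon,\sigma}(\rho^{n+1},\boldsymbol u^n)^-}{\rho^{n+1}_{D_\sigma}}\le\frac12$;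 and $\rho^n_{D_\sigma}/\rho^{n+1}_{D_\sigma}\le\frac32$.
   Formalization: The correction term of the limit scheme is taken as η δt ρ̃_σ (∂π^{n+1})_σ instead of the printed η δt (∂π^{n+1})_σ; the printed formula fails, e.g. for d=1, φ=0, constant ρ̃=2 and constant nonzero U_0. *)

(* Defs.v *)
From HB Require Import structures.
From mathcomp Require Import all_boot all_order all_algebra.
From mathcomp Require Import all_classical all_reals all_analysis.

Set Implicit Arguments.
Unset Strict Implicit.
Unset Printing Implicit Defensive.

Import Order.TTheory GRing.Theory Num.Theory.
Import numFieldNormedType.Exports.

Local Open Scope classical_set_scope.
Local Open Scope ring_scope.

(** The library has no Lebesgue measure on R^d for d > 1: ['rV[R]_d] gets the
    product sigma-algebra, and the measure is the iterated product. *)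

Definition rV_display : measure_display. Proof. exact: default_measure_display. Qed.

Section rV_measurable.
Context (R : realType) (d : nat).

Let coord (i : 'I_d) (x : 'rV[R]_d) : R := x 0 i.

Let rV_set0 : g_sigma_preimage coord set0.
Proof. exact: sigma_algebra0. Qed.

Let rV_setC A : g_sigma_preimage coord A -> g_sigma_preimage coord (~` A).
Proof. exact: sigma_algebraC. Qed.

Let rV_bigcup (F : _^nat) : (forall i, g_sigma_preimage coord (F i)) ->
  g_sigma_preimage coord (\bigcup_i (F i)).
Proof. exact: sigma_algebra_bigcup. Qed.

HB.instance Definition _ := @isMeasurable.Build rV_display
  'rV[R]_d (g_sigma_preimage coord) rV_set0 rV_setC rV_bigcup.

Lemma measurable_coord (i : 'I_d) :
  measurable_fun [set: 'rV[R]_d] (fun x => x 0 i).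
Proof.
move=> _ Y mY; rewrite setTI; apply: sub_sigma_algebra => /=.
rewrite -bigcup_seq/=; exists i => /=; first by rewrite mem_index_enum.
by exists Y => //; rewrite setTI.
Qed.

Lemma measurable_fun_rV d1 (T1 : measurableType d1) (f : T1 -> 'rV[R]_d) :
  (forall i, measurable_fun [set: T1] (fun x => f x 0 i)) ->
  measurable_fun [set: T1] f.
Proof.
move=> mf; apply: (@measurability _ _ _ _ setT f
  (\big[setU/set0]_(i < d) preimage_set_system setT (coord i) measurable)) => //.
move=> _ [B + <-]; rewrite -bigcup_seq => -[i _ [A mA <-]].
by rewrite !setTI -comp_preimage; have := mf i measurableT A mA; rewrite setTI.
Qed.

End rV_measurable.

Section lebesgue_rV.
Context (R : realType).

Definition rV_cons (d : nat) (p : R * 'rV[R]_d) : 'rV[R]_d.+1 :=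
  \row_j (if unlift ord0 j is Some k then p.2 0 k else p.1).

Lemma measurable_rV_cons d : measurable_fun setT (@rV_cons d).
Proof.
apply: measurable_fun_rV => i; under eq_fun do rewrite mxE.
case: unliftP => [k _|_]; last exact: measurable_fst.
exact: (measurableT_comp (@measurable_coord R d k) measurable_snd).
Qed.

Section lebesgue_rV_step.
Context (d : nat) (mu : {sigma_finite_measure set 'rV[R]_d -> \bar R}).

Definition lebesgue_rV_step : set 'rV[R]_d.+1 -> \bar R :=
  pushforward ((@lebesgue_measure R) \x mu)%E (@rV_cons d).

Let m := lebesgue_rV_step.

Let m0 : m set0 = 0%E.
Proof. by rewrite /m /lebesgue_rV_step /pushforward preimage_set0 measure0. Qed.

Let m_ge0 A : (0 <= m A)%E.
Proof. by rewrite /m /lebesgue_rV_step /pushforward; exact: measure_ge0. Qed.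

Let m_sigma_additive : semi_sigma_additive m.
Proof.
have mT (A : set 'rV[R]_d.+1) : measurable A ->
    measurable (@rV_cons d @^-1` A).
  by rewrite -[X in _ -> measurable X]setTI; exact: measurable_rV_cons.
move=> F mF tF mUF; rewrite /m /lebesgue_rV_step /pushforward preimage_bigcup.
apply: measure_semi_sigma_additive => [n||]; first exact: mT.
- apply/trivIsetP => /= i j _ _ ij; rewrite -preimage_setI.
  by move/trivIsetP : tF => /(_ _ _ _ _ ij) ->//; rewrite preimage_set0.
- by rewrite -preimage_bigcup; exact: mT.
Qed.

HB.instance Definition _ :=
  isMeasure.Build _ _ _ lebesgue_rV_step m0 m_ge0 m_sigma_additive.

Let m_sigma_finite : sigma_finite setT m.
Proof.
have /sigma_finiteP[F [TF ndF Foo]] := sigma_finiteT (@lebesgue_measure R).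
have /sigma_finiteP[G [TG ndG Goo]] := sigma_finiteT mu.
pose tl (x : 'rV[R]_d.+1) : 'rV[R]_d := \row_k x 0 (lift ord0 k).
have mtl : measurable_fun setT tl.
  apply: measurable_fun_rV => i; under eq_fun do rewrite mxE.
  exact: measurable_coord.
have mhd := @measurable_coord R d.+1 ord0.
exists (fun n => (fun x : 'rV[R]_d.+1 => x 0 ord0) @^-1` F n `&` tl @^-1` G n).
  apply/esym; rewrite -subTset => x _.
  have [n _ Fn] : (\bigcup_i F i) (x 0 ord0) by rewrite -TF.
  have [k _ Gk] : (\bigcup_i G i) (tl x) by rewrite -TG.
  exists (maxn n k) => //; split => /=.
  - by move: Fn; exact/subsetPset/ndF/leq_maxl.
  - by move: Gk; exact/subsetPset/ndG/leq_maxr.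
move=> n; have [mF Fn] := Foo n; have [mG Gn] := Goo n; split.
  by apply: measurableI; rewrite -[X in measurable X]setTI; [exact: mhd|exact: mtl].
rewrite /m /lebesgue_rV_step /pushforward.
rewrite (_ : _ @^-1` _ = F n `*` G n); last first.
  apply/seteqP; split => -[a v] /=; rewrite mxE unlift_none;
    (have -> : tl (rV_cons (a, v)) = v by
      apply/rowP => k; rewrite !mxE liftK); by [].
by rewrite product_measure1E// lte_mul_pinfty// ge0_fin_numE.
Qed.

HB.instance Definition _ := Measure_isSigmaFinite.Build _ _ _
  lebesgue_rV_step m_sigma_finite.

End lebesgue_rV_step.

Fixpoint lebesgue_rV (d : nat) : {sigma_finite_measure set 'rV[R]_d -> \bar R} :=
  if d is n.+1 then lebesgue_rV_step (lebesgue_rV n) else dirac (0 : 'rV[R]_0).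

End lebesgue_rV.

Section function_spaces.
Context (R : realType) (d : nat).
Implicit Types (Omega : set 'rV[R]_d) (f : 'rV[R]_d -> R).

Definition normLp Omega (p : \bar R) f : \bar R :=
  'N[lebesgue_rV R d]_p[EFin \o (f \_ Omega)].

Definition in_Lp Omega (p : \bar R) f : Prop :=
  measurable_fun Omega f /\ (normLp Omega p f < +oo)%E.

Definition partial (i : 'I_d) f : 'rV[R]_d -> R := 'D_(delta_mx 0 i) f.

(** C^infinity on the open set [V] *)
Definition smooth_on (V : set 'rV[R]_d) f : Prop :=
  forall (s : seq 'I_d) (x : 'rV[R]_d), V x ->
    let g := foldr partial f s in
    {for x, continuous g} /\ forall i, derivable g x (delta_mx 0 i).

Definition test_function Omega f : Prop :=
  smooth_on setT f /\
  exists2 K : set 'rV[R]_d, compact K /\ K `<=` Omega &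
    forall x, ~ K x -> f x = 0.

(** div w = 0 in the sense of distributions on [Omega]. *)
Definition div_free Omega (w : 'rV[R]_d -> 'rV[R]_d) : Prop :=
  forall psi, test_function Omega psi ->
    \int[lebesgue_rV R d]_(x in Omega)
      (\sum_(i < d) w x 0 i * partial i psi x) = 0.

End function_spaces.

Section boxes.
Context (R : realType) (d : nat).

(** A box is given by its lower and upper corners. *)
Definition box : Type := ('rV[R]_d * 'rV[R]_d)%type.

Definition cbox (b : box) : set 'rV[R]_d :=
  [set x | forall j, b.1 0 j <= x 0 j <= b.2 0 j].

Definition obox (b : box) : set 'rV[R]_d :=
  [set x | forall j, b.1 0 j < x 0 j < b.2 0 j].

Definition solid (b : box) : Prop := forall j, b.1 0 j < b.2 0 j.

Definition volume (b : box) : R := \prod_j (b.2 0 j - b.1 0 j).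

Lemma measurable_cbox (b : box) : measurable (cbox b).
Proof.
have -> : cbox b = \big[setI/setT]_(j < d)
    ((fun x : 'rV[R]_d => x 0 j) @^-1` `[b.1 0 j, b.2 0 j]).
  rewrite -bigcap_seq; apply/seteqP; split => x /= h.
    by move=> j _ /=; rewrite in_itv/=; exact: h.
  by move=> j; have := h j; rewrite /= in_itv/=; apply; exact: mem_index_enum.
apply: bigsetI_measurable => j _; rewrite -[X in measurable X]setTI.
by apply: measurable_coord => //; exact: measurable_itv.
Qed.

(** (d-1)-dimensional measure of a box that is flat in direction [i]. *)
Definition area (i : 'I_d) (b : box) : R :=
  \prod_(j | j != i) (b.2 0 j - b.1 0 j).

(** [b] with its [i]-th interval replaced by [[l, u]]. *)
Definition set_itv_coord (b : box) (i : 'I_d) (l u : R) : box :=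
  (\row_j (if j == i then l else b.1 0 j),
   \row_j (if j == i then u else b.2 0 j)).

Definition is_domain (Omega : set 'rV[R]_d) : Prop :=
  [/\ open Omega, connected Omega, bounded_set Omega &
      exists s : seq box, (forall b, b \in s -> solid b) /\
        closure Omega = \bigcup_(b in [set` s]) cbox b].

End boxes.

Lemma lebesgue_rV_cbox (R : realType) (d : nat) (b : box R d) :
  (forall j, b.1 0 j <= b.2 0 j) -> lebesgue_rV R d (cbox b) = (volume b)%:E.
Proof.
elim: d b => [|d IHd] b leb.
  by rewrite /volume big_ord0 /= diracE mem_set// => -[].
pose b' : box R d := (\row_k b.1 0 (lift ord0 k), \row_k b.2 0 (lift ord0 k)).
have cE : @rV_cons R d @^-1` cbox b = `[b.1 0 ord0, b.2 0 ord0] `*` cbox b'.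
  apply/seteqP; split => -[a v] /=.
    move=> h; split => [|k].
      by have := h ord0; rewrite mxE unlift_none in_itv.
    by have := h (lift ord0 k); rewrite !mxE liftK.
  rewrite in_itv/= => -[ha hv] j; rewrite mxE; case: unliftP => [k ->|->//].
  by have := hv k; rewrite !mxE.
rewrite /= /lebesgue_rV_step /pushforward cE product_measure1E//; last first.
  exact: measurable_cbox.
rewrite IHd => [|k]; last by rewrite !mxE.
have lebE : @lebesgue_measure R `[b.1 0 ord0, b.2 0 ord0]%classic =
    (b.2 0 ord0 - b.1 0 ord0)%:E.
  rewrite lebesgue_measure_itv/= lte_fin.
  have := leb ord0; rewrite le_eqVlt => /predU1P[->|->]; last by rewrite -EFinB.
  by rewrite ltxx subrr.
transitivity ((b.2 0 ord0 - b.1 0 ord0)%:E * (volume b')%:E)%E.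
  by congr (_ * _)%E; exact: lebE.
rewrite -EFinM /volume big_ord_recl; congr (_ * _)%:E.
by apply: eq_bigr => i _; rewrite !mxE.
Qed.

(** Conformity: two cells that meet do so along a common (possibly lower
    dimensional) face, i.e. in each coordinate their intervals either coincide
    or only share an end point. *)
Record mac_grid (R : realType) (d : nat) (Omega : set 'rV[R]_d) := MacGrid {
  cell : finType;
  cbx : cell -> box R d;
  cell_solid : forall K, solid (cbx K);
  cell_cover : \bigcup_(K in [set: cell]) cbox (cbx K) = closure Omega;
  cell_disjoint : forall K L, K != L -> obox (cbx K) `&` obox (cbx L) = set0;
  cell_conforming : forall K L, cbox (cbx K) `&` cbox (cbx L) !=set0 ->
    forall i : 'I_d,
      [\/ (cbx K).1 0 i = (cbx L).1 0 i /\ (cbx K).2 0 i = (cbx L).2 0 i,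
          (cbx K).2 0 i = (cbx L).1 0 i | (cbx L).2 0 i = (cbx K).1 0 i]
}.

Section grid.
Context (R : realType) (d : nat) (Omega : set 'rV[R]_d) (M : mac_grid Omega).
Implicit Types (K L : cell M) (i j : 'I_d) (s t : bool).

(** Side [true] of a cell in direction [i] is the one with outward normal
    [e^(i)], side [false] the one with outward normal [- e^(i)].  A face is
    recorded together with the index of the axis it is orthogonal to. *)
Definition side_data K i s : 'I_d * box R d :=
  let a := if s then (cbx K).2 0 i else (cbx K).1 0 i in
  (i, set_itv_coord (cbx K) i a a).

Definition all_sides : seq ('I_d * box R d) :=
  [seq side_data x.1.1 x.1.2 x.2 | x : cell M * 'I_d * bool].

Definition face : Type := seq_sub all_sides.
HB.instance Definition _ := Finite.on face.

Lemma side_subproof K i s : side_data K i s \in all_sides.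
Proof. by apply/mapP; exists (K, i, s) => //; rewrite mem_enum. Qed.

Definition side K i s : face := SeqSub (side_subproof K i s).

Implicit Types (sigma : face).

Definition dir sigma : 'I_d := (val sigma).1.

Definition farea sigma : R := area (dir sigma) (val sigma).2.

(** [cell_at sigma s] is the cell whose side [s] is [sigma]: for an internal
    face [sigma = K|L] with [nu_(sigma,K) = e^(i)], [cell_at sigma true = K] and
    [cell_at sigma false = L]. *)
Definition cell_at sigma s : option (cell M) :=
  [pick K | side K (dir sigma) s == sigma].

Definition internal sigma : bool :=
  isSome (cell_at sigma true) && isSome (cell_at sigma false).

(** [e^(i) . nu_(sigma,K)] for [sigma = side K i s] *)
Definition sgn s : R := if s then 1 else -1.

Definition half_cell K i s : box R d :=
  let l := (cbx K).1 0 i in let u := (cbx K).2 0 i in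
  let m := (l + u) / 2 in
  set_itv_coord (cbx K) i (if s then m else l) (if s then u else m).

Definition dual_cell sigma : set 'rV[R]_d :=
  \bigcup_(s in [set: bool])
    (if cell_at sigma s is Some K then cbox (half_cell K (dir sigma) s)
     else set0).

Definition half_volume sigma s : R :=
  if cell_at sigma s is Some K then volume (half_cell K (dir sigma) s) else 0.

Definition dual_volume sigma : R := \sum_(s : bool) half_volume sigma s.

(** L_M(Omega) and the fields with components constant on dual cells, given by
    their cell and face values. *)
Definition cfun := {ffun cell M -> R}.
Definition ffield := {ffun face -> R}.

Definition H0 : set ffield :=
  [set v | forall sigma, ~~ internal sigma -> v sigma = 0].

Implicit Types (q rho p : cfun) (v w : ffield).

Definition cfun_val q (x : 'rV[R]_d) : R := \sum_K q K * \1_(cbox (cbx K)) x.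

Definition dual_avg q sigma : R :=
  (\sum_(s : bool)
     half_volume sigma s * (if cell_at sigma s is Some K then q K else 0))
  / dual_volume sigma.

(** Means are taken over the part of the cell inside [Omega], the only place
    where the data are given. *)
Definition cell_mean (f : 'rV[R]_d -> R) : cfun :=
  [ffun K => (volume (cbx K))^-1 *
     \int[lebesgue_rV R d]_(x in cbox (cbx K) `&` Omega) f x].

Definition face_mean (f : 'rV[R]_d -> 'rV[R]_d) : ffield :=
  [ffun sigma => if internal sigma then
     (dual_volume sigma)^-1 *
     \int[lebesgue_rV R d]_(x in dual_cell sigma `&` Omega) f x 0 (dir sigma)
   else 0].

Definition grad q : ffield :=
  [ffun sigma =>
    if (cell_at sigma true, cell_at sigma false) is (Some K, Some L)
    then farea sigma / dual_volume sigma * (q L - q K) else 0].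

Section operators.
Context (gamma : R).

Definition pressure (r : R) : R := r `^ gamma.
Definition energy (r : R) : R := r `^ gamma / (gamma - 1).
Definition denergy : R -> R := derive1 energy.

Definition is_interface_value (a b c : R) : Prop :=
  Num.min a b <= c <= Num.max a b /\
  (if a == b then c = a
   else pressure a - pressure b = c * (denergy a - denergy b)).

Definition interface_value (a b : R) : R := get (is_interface_value a b).

Definition face_density rho sigma : R :=
  if (cell_at sigma true, cell_at sigma false) is (Some K, Some L)
  then interface_value (rho K) (rho L) else 0.

(** F_(sigma,K) for [sigma = side K i s] *)
Definition flux rho v K i s : R :=
  let sigma := side K i s in
  if internal sigma
  then farea sigma * face_density rho sigma * (v sigma * sgn s) else 0.

Definition div_flux rho v K : R :=
  (volume (cbx K))^-1 * \sum_i \sum_(s : bool) flux rho v K i s.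

(** The faces of the dual cell of an internal [sigma] are indexed by their
    direction [j] and their side [t].  The face (dir sigma, t) lies inside the
    cell on side [t] of [sigma]; the face (j, t), [j != dir sigma], is made of
    halves of the [j]-sides of the two cells (and the formula gives 0 when both
    of these lie on the boundary). *)
Definition dual_flux rho v sigma j t : R :=
  if j == dir sigma then
    if cell_at sigma (~~ t) is Some K
    then (flux rho v K j t - flux rho v K j (~~ t)) / 2 else 0
  else
    (\sum_(s : bool)
       (if cell_at sigma s is Some K then flux rho v K j t else 0)) / 2.

End operators.

(** The face sigma' such that the dual face (j, t) is D_sigma | D_sigma'.  For
    [j != dir sigma] it is read off from whichever of the two cells above the
    dual face exists; conformity makes the two readings agree. *)
Definition dual_neighbour sigma j t : option face :=
  if j == dir sigma then omap (fun K => side K j t) (cell_at sigma (~~ t))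
  else
    let above s :=
      obind (fun K => cell_at (side K j t) (~~ t)) (cell_at sigma s) in
    if above true is Some K then Some (side K (dir sigma) true)
    else omap (fun L => side L (dir sigma) false) (above false).

(** [F] is the dual flux through (j, t); without neighbour, (j, t) is on the
    boundary and [F = 0]. *)
Definition upwind v sigma j t (F : R) : R :=
  if 0 <= F then v sigma
  else if dual_neighbour sigma j t is Some sigma' then v sigma' else 0.

(** (1/|D_sigma|) sum_eps F_(eps,sigma)(rho, v) w_(eps,up) *)
Definition convection (gamma : R) rho v w sigma : R :=
  (dual_volume sigma)^-1 *
  \sum_j \sum_(t : bool)
    dual_flux gamma rho v sigma j t *
    upwind w sigma j t (dual_flux gamma rho v sigma j t).

Definition negpart (x : R) : R := (`|x| - x) / 2.

Definition is_cfun_norm (N : cfun -> R) : Prop :=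
  [/\ forall q, N q = 0 -> q = 0,
      forall q q', N (q + q') <= N q + N q' &
      forall a q, N [ffun K => a * q K] = `|a| * N q].

Definition is_H0_norm (N : ffield -> R) : Prop :=
  [/\ forall v, H0 v -> N v = 0 -> v = 0,
      forall v w, H0 v -> H0 w -> N (v + w) <= N v + N w &
      forall a v, H0 v -> N [ffun sigma => a * v sigma] = `|a| * N v].

End grid.

Section time.
Context (R : realType).

(** Equal to [w n.+1] on ](n * dt), (n.+1 * dt)]. *)
Definition in_time (V : Type) (dt : R) (w : nat -> V) (t : R) : V :=
  w `|Num.ceil (t / dt)|%N.

Definition normLinfty_time (T : R) (g : R -> \bar R) : \bar R :=
  'N[@lebesgue_measure R]_+oo[g \_ `]0, T[%classic].

End time.

Section data.
Context (R : realType) (d : nat) (Omega : set 'rV[R]_d) (gamma : R).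
Context (phi : 'rV[R]_d -> R).

Definition smooth_potential : Prop :=
  exists2 V : set 'rV[R]_d, open V /\ closure Omega `<=` V & smooth_on V phi.

Definition rho_tilde (C : R) (x : 'rV[R]_d) : R :=
  ((gamma - 1) / gamma * (C - phi x)) `^ (gamma - 1)^-1.

(** [C = C(m0)].  Positivity of [C - phi] is required separately, since [powR]
    takes junk values on negative numbers. *)
Definition hydrostatic (m0 C : R) : Prop :=
  [/\ forall x, Omega x -> 0 < C - phi x,
      exists2 c, 0 < c & forall x, Omega x -> c <= rho_tilde C x &
      \int[lebesgue_rV R d]_(x in Omega) rho_tilde C x = m0].

Definition well_prepared (C : R) (eps : nat -> R)
    (rho0 : nat -> 'rV[R]_d -> R) (u0 : nat -> 'rV[R]_d -> 'rV[R]_d)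
    (U0 : 'rV[R]_d -> 'rV[R]_d) : Prop :=
  [/\ forall k, in_Lp Omega +oo (rho0 k) /\
        forall i, in_Lp Omega +oo (fun x => u0 k x 0 i),
      forall k, {ae lebesgue_rV R d, forall x, Omega x -> 0 < rho0 k x},
      exists r0 : nat -> 'rV[R]_d -> R,
        [/\ forall k, in_Lp Omega +oo (r0 k) /\
              {ae lebesgue_rV R d, forall x, Omega x ->
                 rho0 k x = rho_tilde C x + eps k * r0 k x},
            exists B : R, forall k, (normLp Omega +oo (r0 k) <= B%:E)%E &
            (fun k => normLp Omega 2%:E (r0 k)) @ \oo --> 0%E],
      forall i, in_Lp Omega 2%:E (fun x => U0 x 0 i) /\
        (fun k => normLp Omega 2%:E (fun x => u0 k x 0 i - U0 x 0 i))
          @ \oo --> 0%E &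
      div_free Omega (fun x => rho_tilde C x *: U0 x)].

End data.

Section schemes.
Context (R : realType) (d : nat) (Omega : set 'rV[R]_d) (M : mac_grid Omega).
Context (gamma dt : R).
Implicit Types (rho q : cfun M) (u : ffield M).

Definition rho_tilde_M (phi : 'rV[R]_d -> R) (C : R) : cfun M :=
  cell_mean M (rho_tilde gamma phi C).

Definition phi_M (phi : 'rV[R]_d -> R) (C : R) : cfun M :=
  [ffun K => C - denergy gamma (rho_tilde_M phi C K)].

Definition pressure_M rho : cfun M := [ffun K => pressure gamma (rho K)].

(** Stabilisation parameter eta, from the density at the old time level. *)
Definition eta_stab (eta1 : R) rho (sigma : face M) : R :=
  eta1 / dual_avg rho sigma.

(** The correction field delta u^(n+1), from rho^n and rho^(n+1). *)
Definition correction (eps eta1 : R) (phi rho rho1 : cfun M) : ffield M :=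
  [ffun sigma => if internal sigma then
     eta_stab eta1 rho sigma * dt / eps ^+ 2 *
       (grad (pressure_M rho1) sigma
        + face_density gamma rho1 sigma * grad phi sigma)
   else 0].

(** One time step (rho, u) -> (rho1, u1). *)
Definition scheme_step (eps eta1 : R) (phi rho rho1 : cfun M) (u u1 : ffield M)
    : Prop :=
  let v := u - correction eps eta1 phi rho rho1 in
  (forall K, dt^-1 * (rho1 K - rho K) + div_flux gamma rho1 v K = 0) /\
  (forall sigma, internal sigma ->
     dt^-1 * (dual_avg rho1 sigma * u1 sigma - dual_avg rho sigma * u sigma)
     + convection gamma rho1 v u sigma
     + (eps ^+ 2)^-1 * grad (pressure_M rho1) sigma
     = - (eps ^+ 2)^-1 * (face_density gamma rho1 sigma * grad phi sigma)).

Definition stability (eps eta1 : R) (phi rho rho1 : cfun M) (u : ffield M)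
    : Prop :=
  let v := u - correction eps eta1 phi rho rho1 in
  forall sigma, internal sigma ->
    dt / dual_volume sigma *
      (\sum_j \sum_(t : bool)
         negpart (dual_flux gamma rho1 v sigma j t) / dual_avg rho1 sigma)
      <= 2^-1 /\
    dual_avg rho sigma / dual_avg rho1 sigma <= 3 / 2.

Definition numerical_solution (N : nat) (eps eta1 : R) (phi : cfun M)
    (rho0 : 'rV[R]_d -> R) (u0 : 'rV[R]_d -> 'rV[R]_d)
    (rho : nat -> cfun M) (u : nat -> ffield M) : Prop :=
  [/\ rho 0%N = cell_mean M rho0,
      u 0%N = face_mean M u0 &
      forall n, (n < N)%N ->
        [/\ H0 (u n.+1), forall K, 0 < rho n.+1 K &
            scheme_step eps eta1 phi (rho n) (rho n.+1) (u n) (u n.+1)]].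

(** One step (pi, U) -> (pi1, U1) of the limit scheme; it does not involve pi.
    [dU] is the limit of [correction]: its factor
    eps^-2 (grad p + rho_sigma grad phi) tends to
    [face_density gamma rhot sigma * grad pi1 sigma], the term in the momentum
    equation.  The shorter dU = eta * dt * grad pi1 is not that limit unless
    the face density is 1: for d = 1 and constant rhot = 2, the limit velocity
    satisfies U1 = (1 - 1 / eta1) U, but the shorter formula would give
    U1 = (1 - 2 / eta1) U. *)
Definition limit_step (eta : face M -> R) (rhot pi1 : cfun M) (U U1 : ffield M)
    : Prop :=
  let dU : ffield M := [ffun sigma => if internal sigma then
      eta sigma * dt * (face_density gamma rhot sigma * grad pi1 sigma)
    else 0] in
  (forall K, div_flux gamma rhot (U - dU) K = 0) /\
  (forall sigma, internal sigma ->
     dt^-1 * dual_avg rhot sigma * (U1 sigma - U sigma)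
     + convection gamma rhot (U - dU) U sigma
     + face_density gamma rhot sigma * grad pi1 sigma = 0).

End schemes.

(* Main.v *)
Require Import Defs.

From HB Require Import structures.
From mathcomp Require Import all_boot all_order all_algebra.
From mathcomp Require Import all_classical all_reals all_analysis.
From mathcomp Require Import measurable_realfun ess_sup_inf ring lra.
Import Order.TTheory GRing.Theory Num.Theory.
Import numFieldNormedType.Exports.
Local Open Scope classical_set_scope.
Local Open Scope ring_scope.

Set Implicit Arguments.
Unset Strict Implicit.
Unset Printing Implicit Defensive.

(** On a fixed mesh all norms are equivalent, and the singular terms of the
    scheme can be controlled one time step at a time, by an elliptic equation.

    The face values of the density are chosen so that
      grad p + rho_sigma grad phi
        = rho_sigma grad (h'(rho^(n+1)) - h'(rhot)),
    because phi_K = C - h'(rhot_K).  Put x = eps^(-2) (h'(rho^(n+1)) - h'(rhot)).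
    The stabilising correction inserts eta dt rho_sigma grad x in the mass flux,
    so that the mass balance becomes a discrete elliptic equation for x, with
    coefficients proportional to eta dt rho_sigma^2 and with a right-hand side
    made of rho^(n+1) - rho^n and of div (rho^(n+1) u^n) ([elliptic_eq]).

    The right-hand side is bounded since the total mass is conserved and the
    density positive.  The coefficients stay away from zero: the stability
    condition bounds rho^(n+1) on dual cells from below, and the interface
    density is at least (gamma - 1) / gamma times the larger of its arguments
    ([interface_ge]), so it survives when one of the two cells is nearly empty.
    Summation by parts and a Poincare inequality, which holds because the domain
    is connected and hence the cells are connected through internal faces
    ([cells_connected]), then bound the differences of x between cells
    ([elliptic_estimate]).

    Hence the differences of h'(rho^(n+1)) - h'(rhot) between cells are
    O(eps^2); since the total mass converges to that of rhot, rho^(n+1)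
    converges to rhot ([next_density_cvg]).  Now the coefficients and the
    right-hand side of the elliptic equation converge, so x converges up to a
    constant, by the same estimate ([elliptic_cvg]).  Its limit is the pressure
    pi^(n+1), and the mass and momentum equations pass to the limit term by term
    ([limit_of_step]).  Induction on the time level, started with the means of
    the well-prepared data, gives the theorem. *)

(** * Boxes and the topology of row vectors *)

Section boxes.
Variables (R : realType) (d : nat).
Implicit Types (x y : 'rV[R]_d) (b : box R d).

Lemma open_rV_ball (U : set 'rV[R]_d) x : open U -> U x ->
  exists2 e : R, 0 < e &
    forall y, (forall j, `|x 0 j - y 0 j| < e) -> U y.
Proof.
move=> oU Ux; have /nbhs_ballP[e /= e0 eU] : nbhs x U by exact: open_nbhs_nbhs.
exists e => // y xy; apply: eU; split => // i j.
by rewrite (ord1 i); exact: xy.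
Qed.

Lemma closed_cbox b : closed (cbox b).
Proof.
have -> : cbox b = \bigcap_(j in [set: 'I_d])
    ((fun x : 'rV[R]_d => x 0 j) @^-1` `[b.1 0 j, b.2 0 j]).
  by apply/seteqP; split => x /= h j => [_|]; have := h j; rewrite /= in_itv; exact.
apply: closed_bigI => j _; apply: preimage_closed => [x _|]; last exact: itv_closed.
exact: coord_continuous.
Qed.

Lemma obox_bigsetI b : obox b = \big[setI/setT]_(j < d)
  ((fun x : 'rV[R]_d => x 0 j) @^-1` `]b.1 0 j, b.2 0 j[).
Proof.
rewrite -bigcap_seq; apply/seteqP; split => x /= h.
  by move=> j _ /=; rewrite in_itv/=; exact: h.
by move=> j; have := h j; rewrite /= in_itv/=; apply; exact: mem_index_enum.
Qed.

Lemma open_obox b : open (obox b).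
Proof.
rewrite obox_bigsetI; elim/big_ind : _ => [|A B|j _]; [exact: openT|exact: openI|].
apply: open_comp => [x _|]; last exact: itv_open.
exact: coord_continuous.
Qed.

End boxes.

(** * Cells, faces and their adjacency *)

Section grid_geometry.
Variables (R : realType) (d : nat) (Omega : set 'rV[R]_d) (M : mac_grid Omega).
Implicit Types (K L : cell M) (i j : 'I_d) (s : bool) (sigma : face M).

Lemma cell_eq K L :
  (forall j, Num.max ((cbx K).1 0 j) ((cbx L).1 0 j) <
             Num.min ((cbx K).2 0 j) ((cbx L).2 0 j)) -> K = L.
Proof.
move=> KL; apply/eqP; case: (eqVneq K L) => // /cell_disjoint.
pose z : 'rV[R]_d := \row_j ((Num.max ((cbx K).1 0 j) ((cbx L).1 0 j) +
  Num.min ((cbx K).2 0 j) ((cbx L).2 0 j)) / 2).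
move/seteqP => [/(_ z) + _]; case; split => j; rewrite mxE;
  have := KL j; have := midf_lt (KL j).
  all: move=> [+ +] _; rewrite gt_max lt_min => /andP[h1 h2] /andP[h3 h4].
  by rewrite h1 h3.
by rewrite h2 h4.
Qed.

Lemma cell_same K L :
  (forall j, (cbx K).1 0 j = (cbx L).1 0 j /\ (cbx K).2 0 j = (cbx L).2 0 j) ->
  K = L.
Proof.
by move=> KL; apply: cell_eq => j; have [-> ->] := KL j; rewrite maxxx minxx;
  exact: cell_solid.
Qed.

Lemma side_eq_itv K L i s t j : side K i s = side L i t -> j != i ->
  (cbx K).1 0 j = (cbx L).1 0 j /\ (cbx K).2 0 j = (cbx L).2 0 j.
Proof.
move=> e /negbTE ji.
have /rowP/(_ j) : (val (side K i s)).2.1 = (val (side L i t)).2.1 by rewrite e.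
have /rowP/(_ j) : (val (side K i s)).2.2 = (val (side L i t)).2.2 by rewrite e.
by rewrite !mxE ji.
Qed.

Lemma side_inj K L i s : side K i s = side L i s -> K = L.
Proof.
move=> e; apply: cell_eq => j; have [->|ji] := eqVneq j i; last first.
  by have [-> ->] := side_eq_itv e ji; rewrite maxxx minxx;
    exact: cell_solid.
have /rowP/(_ i) : (val (side K i s)).2.1 = (val (side L i s)).2.1 by rewrite e.
rewrite !mxE eqxx.
have hK := cell_solid K i; have hL := cell_solid L i.
case: s {e} => e; rewrite e in hK *.
  by rewrite minxx gt_max hK.
by rewrite maxxx lt_min hK.
Qed.

Lemma dir_side K i s : dir (side K i s) = i.
Proof. by []. Qed.

Lemma cell_at_side K i s : cell_at (side K i s) s = Some K.
Proof.
rewrite /cell_at dir_side; case: pickP => [L /eqP/side_inj-> //|/(_ K)].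
by rewrite eqxx.
Qed.

Lemma cell_atP sigma s K : cell_at sigma s = Some K -> side K (dir sigma) s = sigma.
Proof. by rewrite /cell_at; case: pickP => // L /eqP + [<-]. Qed.

Lemma internalP sigma : internal sigma ->
  exists K L, cell_at sigma true = Some K /\ cell_at sigma false = Some L.
Proof.
rewrite /internal; case: cell_at => // K; case: cell_at => // L _.
by exists K, L.
Qed.

Lemma internal_cell sigma s : internal sigma -> exists K, cell_at sigma s = Some K.
Proof. by move=> /internalP[K [L [? ?]]]; case: s; [exists K|exists L]. Qed.

Lemma area_gt0 K i s : 0 < farea (side K i s).
Proof.
rewrite /farea /area; apply: prodr_gt0 => j /negbTE ji.
by rewrite !mxE dir_side in ji *; rewrite ji subr_gt0; exact: cell_solid.
Qed.

Lemma farea_gt0 sigma : internal sigma -> 0 < farea sigma.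
Proof.
by move=> /(internal_cell true)[K /cell_atP <-]; exact: area_gt0.
Qed.

Lemma volume_gt0 K : 0 < volume (cbx K).
Proof. by apply: prodr_gt0 => j _; rewrite subr_gt0; exact: cell_solid. Qed.

Lemma half_cell_solid K i s : solid (half_cell K i s).
Proof.
move=> j; rewrite !mxE; case: eqP => [_|_]; last exact: cell_solid.
by have [h1 h2] := midf_lt (cell_solid K i); case: s.
Qed.

Lemma half_volume_gt0 sigma s : internal sigma -> 0 < half_volume sigma s.
Proof.
move=> /(internal_cell s)[K KE]; rewrite /half_volume KE.
by apply: prodr_gt0 => j _; rewrite subr_gt0; exact: half_cell_solid.
Qed.

Lemma dual_volume_gt0 sigma : internal sigma -> 0 < dual_volume sigma.
Proof.
by move=> h; rewrite /dual_volume big_bool/= addr_gt0// half_volume_gt0.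
Qed.

Definition face_adj K L : bool :=
  [exists sigma, (cell_at sigma true == Some K) && (cell_at sigma false == Some L)].

Definition cell_adjacent K L : bool := face_adj K L || face_adj L K.

Lemma face_adj_touch K L i :
  (forall j, j != i ->
     (cbx K).1 0 j = (cbx L).1 0 j /\ (cbx K).2 0 j = (cbx L).2 0 j) ->
  (cbx K).2 0 i = (cbx L).1 0 i -> face_adj K L.
Proof.
move=> KL KLi; apply/existsP; exists (side K i true).
rewrite cell_at_side eqxx /=.
have -> : side K i true = side L i false.
  apply/val_inj; congr (_, _); congr pair; apply/rowP => j; rewrite !mxE;
  by case: eqVneq => [_|/KL[]].
by rewrite cell_at_side eqxx.
Qed.

(** A point [y e] close to [x], on the segment from [x] to a point whose
    coordinates are interior to the intervals of the desired cell, is still in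
    [Omega], hence in some cell; for small [e] that cell also contains [x].
    Conformity then identifies its intervals. *)
Lemma cell_flip K L x i : open Omega -> Omega x -> cbox (cbx K) x ->
    cbox (cbx L) x ->
  exists K', [/\ cbox (cbx K') x,
    (cbx K').1 0 i = (cbx L).1 0 i /\ (cbx K').2 0 i = (cbx L).2 0 i &
    forall j, j != i ->
      (cbx K').1 0 j = (cbx K).1 0 j /\ (cbx K').2 0 j = (cbx K).2 0 j].
Proof.
move=> oO Ox Kx Lx; pose P j := if j == i then L else K.
have Px j : cbox (cbx (P j)) x by rewrite /P; case: ifP.
pose m : 'rV[R]_d := \row_j (((cbx (P j)).1 0 j + (cbx (P j)).2 0 j) / 2).
pose y (e : R) : 'rV[R]_d := x + e *: (m - x).
have cy : y e @[e --> 0^'+] --> x.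
  rewrite -[X in _ --> X]addr0 -[X in _ + X](scale0r (m - x)).
  apply: cvg_at_right_filter; apply: cvgD; first exact: cvg_cst.
  by apply: cvgZr_tmp; exact: cvg_id.
have : \forall e \near 0^'+, Omega (y e) /\
    (forall K', ~ cbox (cbx K') x -> ~ cbox (cbx K') (y e)).
  apply: filterI; first by apply: cy; exact: open_nbhs_nbhs.
  apply: (@filter_forall _ _
    (fun K' e => ~ cbox (cbx K') x -> ~ cbox (cbx K') (y e)) 0^'+ _) => K'.
  have [xK'|xK'] := pselect (cbox (cbx K') x); first exact: nearW.
  have : \forall e \near 0^'+, (~` cbox (cbx K')) (y e).
    apply: (cy (~` cbox (cbx K'))); apply: open_nbhs_nbhs; split => //.
    exact/closed_openC/closed_cbox.
  by apply: filterS.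
move=> H.
have [e [[Oye ye] e0 e1]] : exists e, [/\ (Omega (y e) /\
    (forall K', ~ cbox (cbx K') x -> ~ cbox (cbx K') (y e))), 0 < e & e < 1].
  near (0 : R)^'+ => e; exists e; split; first by near: e; exact: H.
    by near: e; exact: nbhs_right_gt.
  by near: e; exact: nbhs_right_lt.
have : (closure Omega) (y e) by apply: subset_closure.
rewrite -(cell_cover M) => -[K' _ K'y].
have K'x : cbox (cbx K') x by apply: contrapT => /ye.
have key j : (cbx K').1 0 j = (cbx (P j)).1 0 j /\
             (cbx K').2 0 j = (cbx (P j)).2 0 j.
  have meet : cbox (cbx K') `&` cbox (cbx (P j)) !=set0.
    by exists x; split => //; exact: Px.
  have := cell_solid (P j) j; have /andP[] := Px j j; have /andP[] := K'y j.
  rewrite !mxE; set l := (cbx (P j)).1 0 j; set r := (cbx (P j)).2 0 j.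
  by case: (cell_conforming meet j); rewrite -/l -/r => // ->; nra.
exists K'; split => //; first by have := key i; rewrite /P eqxx.
by move=> j /negbTE ji; have := key j; rewrite /P ji.
Unshelve. all: by end_near. Qed.

(** Flipping the coordinates in which the two cells differ one at a time
    crosses one face at each step. *)
Lemma connect_at_point x K L : open Omega -> Omega x ->
  cbox (cbx K) x -> cbox (cbx L) x -> connect cell_adjacent K L.
Proof.
move=> oO Ox; pose D K := [set j | ((cbx K).1 0 j != (cbx L).1 0 j) ||
                                 ((cbx K).2 0 j != (cbx L).2 0 j)]%SET.
have [n] := ubnP #|D K|; elim: n K => // n IHn K; rewrite ltnS => Dn Kx Lx.
have [D0|[i iD]] := set_0Vmem (D K).
  rewrite (@cell_same K L) ?connect0// => j.
  have : j \notin D K by rewrite D0 inE.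
  by rewrite !inE negb_or !negbK => /andP[/eqP-> /eqP->].
have [K' [K'x K'i K'j]] := cell_flip i oO Ox Kx Lx.
apply: (@connect_trans _ _ K').
  apply/connect1/orP.
  have meet : cbox (cbx K) `&` cbox (cbx K') !=set0 by exists x.
  have sym j : j != i -> (cbx K).1 0 j = (cbx K').1 0 j /\
      (cbx K).2 0 j = (cbx K').2 0 j by move=> /K'j[-> ->].
  case: (cell_conforming meet i) => [[h1 h2]|h|h].
  - by move: iD; case: K'i; rewrite !inE h1 h2 => -> ->; rewrite !eqxx.
  - by left; exact: face_adj_touch h.
  - by right; exact: face_adj_touch h.
apply: IHn => //; apply: (leq_trans _ Dn); apply: proper_card; apply/properP.
split; last first.
  by exists i => //; rewrite inE; case: K'i => -> ->; rewrite !eqxx.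
apply/fintype.subsetP => j; rewrite !inE; have [->|ji] := eqVneq j i.
  by case: K'i => -> ->; rewrite !eqxx.
by have [-> ->] := K'j _ ji.
Qed.

Lemma meets_domain K : Omega `&` obox (cbx K) !=set0.
Proof.
pose z : 'rV[R]_d := \row_j (((cbx K).1 0 j + (cbx K).2 0 j) / 2).
have oz : obox (cbx K) z.
  by move=> j; rewrite mxE; have [-> ->] := midf_lt (cell_solid K j).
have : closure Omega z.
  rewrite -(cell_cover M); exists K => // j.
  by have /andP[/ltW-> /ltW->] := oz j.
by apply; apply: open_nbhs_nbhs; split => //; exact: open_obox.
Qed.

(** The cells connected to [K] and the other ones cover two relatively closed
    parts of [Omega]; these parts are disjoint by [connect_at_point]. *)
Lemma cells_connected K L : open Omega -> connected Omega ->
  connect cell_adjacent K L.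
Proof.
move=> oO cO.
pose A := \bigcup_(K' in [set K' | connect cell_adjacent K K']) cbox (cbx K').
pose B := \bigcup_(K' in [set K' | ~~ connect cell_adjacent K K']) cbox (cbx K').
have fin (P : set (cell M)) : closed (\bigcup_(K' in P) cbox (cbx K')).
  apply: closed_bigcup => [|K' _]; first exact: finite_finset.
  exact: closed_cbox.
have AB : Omega `&` A = Omega `&` ~` B.
  apply/seteqP; split => x [Ox].
    move=> [K' KK' K'x]; split => // -[L' /negP KL' L'x]; apply: KL'.
    exact: connect_trans KK' (connect_at_point oO Ox K'x L'x).
  move=> nB; split => //.
  have : closure Omega x by exact: subset_closure.
  rewrite -(cell_cover M) => -[K' _ K'x]; exists K' => //=.
  by apply/negPn/negP => KK'; apply: nB; exists K'.
have OA : Omega `&` A = Omega.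
  apply: cO.
  - have [x [Ox Kx]] := meets_domain K; exists x; split => //; exists K => /=.
      exact: connect0.
    by move=> j; have /andP[/ltW-> /ltW->] := Kx j.
  - by exists (~` B) => //; exact/closed_openC/fin.
  - by exists A => //; exact: fin.
have [x [Ox Lx]] := meets_domain L.
have : (Omega `&` A) x by rewrite OA.
move=> [_ [K' /= KK' K'x]]; apply: (connect_trans KK').
apply: (connect_at_point oO Ox) => // j.
by have /andP[/ltW-> /ltW->] := Lx j.
Qed.

End grid_geometry.

(** * Sequences of reals *)

Section sequences.
Variable R : realType.
Implicit Types (f g : nat -> R) (a b c : R).

Definition ev_bounded f := exists B, \forall k \near \oo, `|f k| <= B.

Lemma ev_bounded_cvg f a : f @ \oo --> a -> ev_bounded f.
Proof.
move=> fa; exists (`|a| + 1); apply: (cvgr_norm_le _ fa).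
by rewrite ltrDl.
Qed.

Lemma ev_boundedN f : ev_bounded f -> ev_bounded (fun k => - f k).
Proof. by move=> [B h]; exists B; under eq_near do rewrite normrN. Qed.

Lemma ev_boundedD f g : ev_bounded f -> ev_bounded g ->
  ev_bounded (fun k => f k + g k).
Proof.
move=> [B fB] [B' gB]; exists (B + B'); near=> k.
by rewrite (le_trans (ler_normD _ _))// lerD//; near: k.
Unshelve. all: by end_near. Qed.

Lemma ev_boundedM f g : ev_bounded f -> ev_bounded g ->
  ev_bounded (fun k => f k * g k).
Proof.
move=> [B fB] [B' gB]; exists (B * B'); near=> k.
by rewrite normrM ler_pM//; near: k.
Unshelve. all: by end_near. Qed.

Lemma ev_bounded_sum (I : Type) (r : seq I) (P : pred I) (f : I -> nat -> R) :
  (forall i, P i -> ev_bounded (f i)) ->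
  ev_bounded (fun k => \sum_(i <- r | P i) f i k).
Proof.
move=> fB; elim: r => [|i r IH].
  by exists 0; apply: nearW => k; rewrite big_nil normr0.
have [Pi|Pi] := boolP (P i).
  rewrite (_ : (fun _ => _) = f i \+ (fun k => \sum_(j <- r | P j) f j k)).
    by apply: ev_boundedD => //; exact: fB.
  by apply/funext => k; rewrite big_cons Pi.
rewrite (_ : (fun _ => _) = (fun k => \sum_(j <- r | P j) f j k))//.
by apply/funext => k; rewrite big_cons (negbTE Pi).
Qed.

Lemma cvg_bigsum (I : Type) (r : seq I) (P : pred I) (f : I -> nat -> R)
    (a : I -> R) : (forall i, P i -> f i @ \oo --> a i) ->
  (fun k => \sum_(i <- r | P i) f i k) @ \oo --> \sum_(i <- r | P i) a i.
Proof.
move=> fa; elim: r => [|i r IH].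
  rewrite big_nil (_ : (fun _ => _) = cst 0); first exact: cvg_cst.
  by apply/funext => k; rewrite big_nil.
rewrite big_cons; case: ifP => Pi.
  rewrite (_ : (fun _ => _) = f i \+ (fun k => \sum_(j <- r | P j) f j k)).
    by apply: cvgD => //; exact: fa.
  by apply/funext => k; rewrite big_cons Pi.
rewrite (_ : (fun _ => _) = (fun k => \sum_(j <- r | P j) f j k))//.
by apply/funext => k; rewrite big_cons Pi.
Qed.

Lemma cvg_bigsum0 (I : Type) (r : seq I) (P : pred I) (f : I -> nat -> R) :
  (forall i, P i -> f i @ \oo --> 0) ->
  (fun k => \sum_(i <- r | P i) f i k) @ \oo --> 0.
Proof. by move=> /(@cvg_bigsum _ r P f (fun=> 0)); rewrite big1. Qed.

Lemma cvg0_dominated f g : (\forall k \near \oo, `|f k| <= g k) ->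
  g @ \oo --> 0 -> f @ \oo --> 0.
Proof.
move=> fg g0; apply/norm_cvg0P.
apply: (@squeeze_cvgr _ _ _ _ (fun=> 0) g _ _ _ (cvg_cst _) g0).
by near=> k; rewrite normr_ge0/=; near: k.
Unshelve. all: by end_near. Qed.

Lemma cvg0_bounded f g : f @ \oo --> 0 -> ev_bounded g ->
  (fun k => f k * g k) @ \oo --> 0.
Proof.
move=> f0 [B gB]; apply: (@cvg0_dominated _ (fun k => `|f k| * B)).
  by near=> k; rewrite normrM ler_wpM2l//; near: k.
rewrite -(mul0r B); apply: cvgM; last exact: cvg_cst.
exact/norm_cvg0P.
Unshelve. all: by end_near. Qed.

Lemma cvg_of_dist0 f a : (fun k => f k - a) @ \oo --> 0 -> f @ \oo --> a.
Proof. by move/cvg_sub0 => /(_ _ (cvg_cst a)); exact. Qed.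

Lemma dist0_of_cvg f a : f @ \oo --> a -> (fun k => f k - a) @ \oo --> 0.
Proof. by move=> fa; rewrite -(subrr a); apply: cvgB => //; exact: cvg_cst. Qed.

Lemma cvg_cauchy_dominated f g c : 0 <= c -> g @ \oo --> 0 ->
  (forall k l, `|f k - f l| <= c * (g k + g l)) -> exists a, f @ \oo --> a.
Proof.
move=> c0 g0 fg; apply/cvg_ex; apply: R_complete; apply: cauchy_exP => e e0.
have d0 : 0 < e / (2 * (c + 1)) by rewrite divr_gt0// mulr_gt0// ltr_wpDl.
have gd : \forall k \near \oo, g k < e / (2 * (c + 1)) by exact: (cvgr_lt 0).
near \oo => k; exists (f k).
suff : \forall l \near \oo, `|f k - f l| < e by [].
near=> l; rewrite (le_lt_trans (fg k l))//.
have gk : g k < e / (2 * (c + 1)) by near: k.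
have gl : g l < e / (2 * (c + 1)) by near: l.
have -> : e = 2 * (c + 1) * (e / (2 * (c + 1))).
  by rewrite mulrC divfK// mulf_neq0// gt_eqF// ltr_wpDl.
move: (e / _) d0 gk gl => D d0 gk gl.
have : c * (g k + g l) <= c * (D + D) by rewrite ler_wpM2l// lerD// ltW.
lra.
Unshelve. all: by end_near. Qed.

Definition ev_pos f := exists2 c, 0 < c & \forall k \near \oo, c <= f k.

Lemma ev_pos_cvg f a : 0 < a -> f @ \oo --> a -> ev_pos f.
Proof.
move=> a0 fa; exists (a / 2); first by rewrite divr_gt0.
by apply: (cvgr_ge _ fa); rewrite ltr_pdivrMr// ltr_pMr// ltr1n.
Qed.

Lemma ev_posM f g : ev_pos f -> ev_pos g -> ev_pos (fun k => f k * g k).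
Proof.
move=> [c c0 fc] [c' c'0 gc]; exists (c * c'); first exact: mulr_gt0.
by near=> k; rewrite ler_pM ?(ltW c0) ?(ltW c'0)//; near: k.
Unshelve. all: by end_near. Qed.

Lemma ev_pos_ge f g : ev_pos f -> (\forall k \near \oo, f k <= g k) -> ev_pos g.
Proof.
move=> [c c0 fc] fg; exists c => //; near=> k.
by apply: (@le_trans _ _ (f k)); near: k.
Unshelve. all: by end_near. Qed.

Lemma ev_pos_all (I : finType) (P : pred I) (f : I -> nat -> R) :
  (forall i, P i -> ev_pos (f i)) ->
  exists2 c, 0 < c & \forall k \near \oo, forall i, P i -> c <= f i k.
Proof.
move=> fP.
have /fin_all_exists[c cP] : forall i, exists c : R, 0 < c /\
    (P i -> \forall k \near \oo, c <= f i k).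
  move=> i; case: (boolP (P i)) => [/fP[c c0 fc]|_]; first by exists c.
  by exists 1.
exists (\big[Num.min/1]_i c i).
  by elim/big_ind : _ => // [x y x0 y0|i _]; [rewrite lt_min x0|have [] := cP i].
apply: (@filter_forall _ _ (fun i k => P i -> _ <= f i k) \oo _) => i.
case: (boolP (P i)) => [Pi|_]; last exact: nearW.
have [_ /(_ Pi)] := cP i; apply: filterS => k ck _.
by rewrite (le_trans _ ck)// bigmin_le_cond.
Qed.

End sequences.

(** * Summation by parts and the discrete elliptic estimate *)

Section elliptic.
Variables (R : realType) (d : nat) (Omega : set 'rV[R]_d) (M : mac_grid Omega).
Implicit Types (K L : cell M) (sigma : face M) (y : cfun M).

Definition jump y sigma : R :=
  if (cell_at sigma true, cell_at sigma false) is (Some K, Some L)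
  then y K - y L else 0.

(** For [G = farea * rho_sigma * v] this is the divergence times the volume of
    the cell; see [div_fluxE]. *)
Definition outflow (G : face M -> R) K : R :=
  \sum_i \sum_(s : bool)
    (if internal (side K i s) then G (side K i s) * sgn R s else 0).

Lemma jumpE y sigma K L : cell_at sigma true = Some K ->
  cell_at sigma false = Some L -> jump y sigma = y K - y L.
Proof. by move=> hK hL; rewrite /jump hK hL. Qed.

Lemma cfunB y y' K : (y - y') K = y K - y' K.
Proof. by rewrite !ffunE. Qed.

Lemma jumpB y y' sigma : jump (y - y') sigma = jump y sigma - jump y' sigma.
Proof.
rewrite /jump; case: cell_at => [K|]; last by rewrite subr0.
by case: cell_at => [L|]; rewrite ?subr0// !ffunE; ring.
Qed.

Lemma eq_outflow (G H : face M -> R) K :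
  (forall sigma, internal sigma -> G sigma = H sigma) -> outflow G K = outflow H K.
Proof.
move=> GH; apply: eq_bigr => i _; apply: eq_bigr => s _.
by case: ifP => // /GH ->.
Qed.

Lemma outflowB (G H : face M -> R) K :
  outflow G K - outflow H K = outflow (fun sigma => G sigma - H sigma) K.
Proof.
rewrite /outflow -sumrB; apply: eq_bigr => i _; rewrite -sumrB.
by apply: eq_bigr => s _; case: ifP => _; rewrite ?subr0// mulrBl.
Qed.

(** A face is counted once, by its cell on side [s] and by its direction. *)
Lemma sum_sides s (H : cell M -> face M -> R) :
  \sum_K \sum_i H K (side K i s) =
  \sum_sigma (if cell_at sigma s is Some K then H K sigma else 0).
Proof.
transitivity (\sum_sigma \sum_(K | cell_at sigma s == Some K) H K sigma).
  rewrite [RHS](exchange_big_dep predT)//=; apply: eq_bigr => K _.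
  rewrite [RHS](reindex_onto (fun i => side K i s) (@dir _ _ _ _)) /=; last first.
    by move=> sigma /eqP; exact: cell_atP.
  by apply: eq_bigl => i; rewrite dir_side cell_at_side !eqxx.
apply: eq_bigr => sigma _; case: cell_at => [K|]; last by rewrite big_pred0.
by rewrite (big_pred1 K)// => L; rewrite eq_sym.
Qed.

(** Summation by parts: an internal face is met from its two sides with
    opposite signs. *)
Lemma sum_outflow (G : face M -> R) y :
  \sum_K y K * outflow G K = \sum_(sigma | internal sigma) G sigma * jump y sigma.
Proof.
transitivity (\sum_(s : bool) \sum_K \sum_i
    (if internal (side K i s) then y K * (G (side K i s) * sgn R s) else 0)).
  rewrite exchange_big /=; apply: eq_bigr => K _.
  rewrite /outflow mulr_sumr exchange_big /=; apply: eq_bigr => i _.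
  rewrite mulr_sumr; apply: eq_bigr => s _.
  by case: ifP => _; rewrite ?mulr0.
under eq_bigr => s _ do rewrite (@sum_sides s (fun K sigma =>
  if internal sigma then y K * (G sigma * sgn R s) else 0)).
rewrite big_bool/= -big_split [RHS]big_mkcond/=; apply: eq_bigr => sigma _.
case: ifPn => [/internalP[K [L [hK hL]]]|_].
  by rewrite (jumpE _ hK hL) hK hL /sgn; ring.
by case: cell_at; case: cell_at; rewrite ?addr0.
Qed.

Lemma sum_outflow0 (G : face M -> R) : \sum_K outflow G K = 0.
Proof.
have := sum_outflow G [ffun=> 1].
under eq_bigr do rewrite ffunE mul1r.
move=> ->; apply: big1 => sigma /internalP[K [L [hK hL]]].
by rewrite (jumpE _ hK hL) !ffunE subrr mulr0.
Qed.

Lemma jump_le_sum y K L : cell_adjacent K L ->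
  `|y K - y L| <= \sum_(sigma | internal sigma) `|jump y sigma|.
Proof.
have key K' L' : face_adj K' L' ->
    `|y K' - y L'| <= \sum_(sigma | internal sigma) `|jump y sigma|.
  case/existsP => sigma /andP[/eqP hK /eqP hL].
  have is_int : internal sigma by rewrite /internal hK hL.
  by rewrite (bigD1 sigma)//= -(jumpE _ hK hL) lerDl sumr_ge0.
by case/orP => /key //; rewrite distrC.
Qed.

(** The differences telescope along a path of adjacent cells. *)
Lemma poincare : open Omega -> connected Omega ->
  exists2 c : R, 0 <= c & forall y K L,
    `|y K - y L| <= c * \sum_(sigma | internal sigma) `|jump y sigma|.
Proof.
move=> oO cO.
have /fin_all_exists[n nP] : forall KL : cell M * cell M, exists n : nat,
    forall y, `|y KL.1 - y KL.2| <=
      n%:R * \sum_(sigma | internal sigma) `|jump y sigma|.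
  case=> K L /=; have /connectP[p pP ->] := cells_connected K L oO cO.
  exists (size p) => y; elim: p K pP => [|K' p IH] K /=.
    by rewrite subrr normr0 mul0r.
  move=> /andP[/(jump_le_sum y) KK' /IH h]; rewrite -natr1 mulrDl mul1r.
  by rewrite (le_trans (ler_distD (y K') _ _))// addrC lerD.
exists (\sum_KL n KL)%:R => // y K L; apply: (le_trans (nP (K, L) y)).
rewrite ler_wpM2r ?sumr_ge0// ler_nat.
by rewrite (bigD1 (K, L))//= leq_addr.
Qed.

(** Cauchy-Schwarz against a constant, from the sum of the squares
    [(n * f i - S) ^+ 2]. *)
Lemma sqr_sum_le (I : finType) (P : pred I) (f : I -> R) :
  (\sum_(i | P i) f i) ^+ 2 <= #|I|%:R * \sum_(i | P i) f i ^+ 2.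
Proof.
set S := \sum_(i | P i) f i; set Q := \sum_(i | P i) f i ^+ 2; set n := #|I|%:R.
have [n0|n0] := eqVneq #|I| 0.
  by rewrite /S big1 ?expr0n ?mulr_ge0 ?sumr_ge0// => i; move: (fintype0 i).
have n_gt0 : 0 < n :> R by rewrite ltr0n lt0n.
have : 0 <= \sum_(i | P i) (n * f i - S) ^+ 2.
  by apply: sumr_ge0 => i _; exact: sqr_ge0.
have -> : \sum_(i | P i) (n * f i - S) ^+ 2 =
    n ^+ 2 * Q - 2 * n * S * S + \sum_(i | P i) S ^+ 2.
  rewrite {3}/S mulr_sumr mulr_sumr -sumrB -big_split /=.
  by apply: eq_bigr => i _; ring.
have : \sum_(i | P i) S ^+ 2 <= n * S ^+ 2.
  rewrite sumr_const -mulr_natl ler_wpM2r ?sqr_ge0// ler_nat.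
  exact: max_card.
move: (\sum_(i | P i) S ^+ 2) => U hU h; clearbody S Q n.
by rewrite -(ler_pM2l n_gt0); rewrite !expr2 in hU h *; lra.
Qed.

(** Testing the equation with [y - y K] gives the energy of [y] on the left; by
    the Poincare inequality the right-hand side is at most the sum of the jumps
    times the data, and one power of that sum cancels. *)
Lemma elliptic_estimate (a0 : R) : open Omega -> connected Omega -> 0 < a0 ->
  exists2 c : R, 0 <= c & forall (a : face M -> R) y K L,
    (forall sigma, internal sigma -> a0 <= a sigma) ->
    `|y K - y L| <=
      c * \sum_K' `|outflow (fun sigma => a sigma * jump y sigma) K'|.
Proof.
move=> oO cO a0_gt0; have [c c0 cP] := poincare oO cO.
set n : R := #|{: face M}|%:R.
exists (c * (c * n / a0)); first by rewrite !mulr_ge0 ?invr_ge0 ?(ltW a0_gt0) /n ?ler0n.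
move=> a y K L aP; apply: (le_trans (cP y K L)); rewrite -mulrA ler_wpM2l//.
set S := \sum_(sigma | _) _; set B := \sum_K' _.
have S0 : 0 <= S by exact: sumr_ge0.
have B0 : 0 <= B by exact: sumr_ge0.
pose z : cfun M := [ffun K' => y K' - y K].
have jz sigma : internal sigma -> jump z sigma = jump y sigma.
  move=> /internalP[K' [L' [hK hL]]].
  by rewrite !(jumpE _ hK hL) !ffunE; ring.
have zB : \sum_K' z K' * outflow (fun sigma => a sigma * jump y sigma) K' <=
    c * S * B.
  rewrite /B mulr_sumr; apply: ler_sum => K' _.
  apply: (le_trans (ler_norm _)); rewrite normrM ler_wpM2r//.
  by rewrite ffunE; exact: cP.
have zJ : a0 * \sum_(sigma | internal sigma) `|jump y sigma| ^+ 2 <=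
    \sum_K' z K' * outflow (fun sigma => a sigma * jump y sigma) K'.
  rewrite sum_outflow mulr_sumr; apply: ler_sum => sigma isig.
  by rewrite jz// -mulrA -expr2 real_normK ?num_real// ler_wpM2r ?sqr_ge0// aP.
have SS : a0 * S ^+ 2 <= n * (c * S * B).
  apply: (@le_trans _ _ (n * (a0 * \sum_(sigma | internal sigma) `|jump y sigma| ^+ 2))).
    by rewrite [leRHS]mulrCA ler_wpM2l ?(ltW a0_gt0)//; exact: sqr_sum_le.
  by rewrite ler_wpM2l// (le_trans zJ).
have -> : c * n / a0 * B = c * n * B / a0 by rewrite mulrAC.
rewrite ler_pdivlMr//; have [->|Sn0] := eqVneq S 0.
  by rewrite mul0r !mulr_ge0.
rewrite -(@ler_pM2l _ S) ?lt_neqAle ?S0 ?andbT 1?eq_sym//.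
by move: SS; rewrite expr2; nra.
Qed.

(** The solution operator is continuous: if the right-hand sides converge then
    the differences between two cells form Cauchy sequences, by the elliptic
    estimate applied to [y k - y l]. *)
Lemma elliptic_cvg (a : face M -> R) (y : nat -> cfun M) (b : cell M -> R) :
  open Omega -> connected Omega -> (forall sigma, internal sigma -> 0 < a sigma) ->
  (forall K, (fun k => outflow (fun sigma => a sigma * jump (y k) sigma) K)
    @ \oo --> b K) ->
  exists p : cfun M, forall sigma, internal sigma ->
    (fun k => jump (y k) sigma) @ \oo --> jump p sigma.
Proof.
move=> oO cO a_gt0 yb.
have [a0 a0_gt0 a0P] : exists2 c, 0 < c & forall sigma, internal sigma -> c <= a sigma.
  have [|c c0 cP] := @ev_pos_all _ _ (@internal _ _ _ M) (fun sigma (_ : nat) => a sigma).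
    by move=> sigma hs; exists (a sigma); [exact: a_gt0|exact: nearW].
  by exists c => //; near \oo => k; near: k.
have [c c0 cP] := @elliptic_estimate a0 oO cO a0_gt0.
pose res k K := outflow (fun sigma => a sigma * jump (y k) sigma) K.
have y_cvg K L : exists p : R, (fun k => y k K - y k L) @ \oo --> p.
  apply: (@cvg_cauchy_dominated _ _ (fun k => \sum_K' `|res k K' - b K'|) _ c0).
    apply: cvg_bigsum0 => K' _; apply/norm_cvg0P.
    by apply: dist0_of_cvg; exact: yb.
  move=> k l; have -> : y k K - y k L - (y l K - y l L) =
      (y k - y l) K - (y k - y l) L by rewrite !cfunB; ring.
  apply: (le_trans (cP a (y k - y l) K L a0P)); rewrite ler_wpM2l//.
  rewrite -big_split/=; apply: ler_sum => K' _.
  have -> : outflow (fun sigma => a sigma * jump (y k - y l) sigma) K' =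
      (res k K' - b K') - (res l K' - b K').
    rewrite (_ : _ - _ = res k K' - res l K'); last by ring.
    by rewrite outflowB; apply: eq_outflow => sigma _; rewrite jumpB mulrBr.
  exact: ler_normB.
pose ref k := if [pick K : cell M | true] is Some K then y k K else 0.
have /fin_all_exists[p pP] : forall K, exists p : R,
    (fun k => y k K - ref k) @ \oo --> p.
  by move=> K; rewrite /ref; case: pickP => [L _|/(_ K)//]; exact: y_cvg.
exists [ffun K => p K] => sigma /internalP[K [L [hK hL]]].
rewrite (jumpE _ hK hL) !ffunE.
rewrite (_ : (fun _ => _) = (fun k => (y k K - ref k) - (y k L - ref k))).
  by apply: cvgB; exact: pP.
by apply/funext => k; rewrite (jumpE _ hK hL); ring.
Unshelve. all: by end_near. Qed.

End elliptic.

(** * The interface density *)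

Lemma cvg_maxr (R : realType) (f g : nat -> R) a b :
  f @ \oo --> a -> g @ \oo --> b ->
  (fun k => Num.max (f k) (g k)) @ \oo --> Num.max a b.
Proof.
move=> fa gb; rewrite maxr_absE; under eq_fun do rewrite maxr_absE.
apply: cvgM; last exact: cvg_cst.
by apply: cvgD; [exact: cvgD|apply: cvg_norm; exact: cvgB].
Qed.

Lemma cvg_minr (R : realType) (f g : nat -> R) a b :
  f @ \oo --> a -> g @ \oo --> b ->
  (fun k => Num.min (f k) (g k)) @ \oo --> Num.min a b.
Proof.
move=> fa gb; rewrite minr_absE; under eq_fun do rewrite minr_absE.
apply: cvgM; last exact: cvg_cst.
by apply: cvgB; [exact: cvgD|apply: cvg_norm; exact: cvgB].
Qed.

Section interface_density.
Variables (R : realType) (gamma : R).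
Hypothesis gamma_gt1 : 1 < gamma.
Implicit Types a b c x y : R.

Lemma denergyE a : 0 < a -> denergy gamma a = gamma / (gamma - 1) * a `^ (gamma - 1).
Proof.
move=> a0; rewrite /denergy derive1E.
have -> : energy gamma = (gamma - 1)^-1 \*: (@powR R ^~ gamma).
  by apply/funext => r; rewrite /energy /= mulrC.
have dP := is_derive1_powR gamma a0.
by rewrite deriveZ// derive_val /GRing.scale/= mulrA; congr (_ * _); rewrite mulrC.
Qed.

Lemma powR_cvg (p : R) (f : nat -> R) a : 0 < a -> f @ \oo --> a ->
  (fun k => f k `^ p) @ \oo --> a `^ p.
Proof.
move=> a0 fa; have pc : {for a, continuous (@powR R ^~ p)}.
  apply/differentiable_continuous/derivable1_diffP.
  by apply: ex_derive; exact: is_derive1_powR.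
exact: (cvg_comp _ _ fa pc).
Qed.

Lemma denergy_mono a b : 0 < a -> 0 < b -> a < b -> denergy gamma a < denergy gamma b.
Proof.
move=> a0 b0 ab; rewrite !denergyE// ltr_pM2l.
  by rewrite gt0_ltr_powR// ?nnegrE ?subr_gt0// ltW.
by rewrite divr_gt0 ?subr_gt0// (lt_trans ltr01).
Qed.

Lemma denergy_cvg (f : nat -> R) a : 0 < a -> f @ \oo --> a ->
  (fun k => denergy gamma (f k)) @ \oo --> denergy gamma a.
Proof.
move=> a0 fa; rewrite denergyE//.
apply: (@cvg_trans _ ((fun k => gamma / (gamma - 1) * f k `^ (gamma - 1)) @ \oo)).
  apply: near_eq_cvg; near=> k; rewrite denergyE//.
  by near: k; apply: (cvgr_gt a).
by apply: cvgM; [exact: cvg_cst|exact: powR_cvg].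
Unshelve. all: by end_near. Qed.

(** Young's inequality for [x] and [y `^ (gamma - 1)], with the conjugate
    exponents [gamma] and [gamma / (gamma - 1)]. *)
Lemma young x y : 0 <= x -> 0 <= y ->
  gamma * (x * y `^ (gamma - 1)) <= x `^ gamma + (gamma - 1) * y `^ gamma.
Proof.
move=> x0 y0; have g0 : 0 < gamma by rewrite (lt_trans ltr01).
have g1 : 0 < gamma - 1 by rewrite subr_gt0.
have := @conjugate_powR _ x (y `^ (gamma - 1)) gamma (gamma / (gamma - 1)) x0
  (powR_ge0 _ _) g0 (divr_gt0 g0 g1).
have -> : gamma^-1 + (gamma / (gamma - 1))^-1 = 1 by field; lra.
rewrite -powRrM (_ : (gamma - 1) * (gamma / (gamma - 1)) = gamma); last by field; lra.
move=> /(_ erefl); rewrite -(ler_pM2l g0) => /le_trans; apply.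
rewrite le_eqVlt; apply/orP; left; apply/eqP.
by field; lra.
Qed.

Lemma powR_gammaE a : 0 <= a -> a `^ gamma = a * a `^ (gamma - 1).
Proof.
move=> a0; have [->|an0] := eqVneq a 0.
  by rewrite mul0r powR0// gt_eqF// (lt_trans ltr01).
by rewrite -{2}(powRr1 a0) -powRD ?an0 ?implybT// addrC subrK.
Qed.

Lemma denergy_slope a b : 0 < b -> b < a ->
  0 < denergy gamma a - denergy gamma b.
Proof. by move=> b0 ba; rewrite subr_gt0 denergy_mono// (lt_trans b0). Qed.

(** Both bounds are Young's inequality, with the roles of [a] and [b]
    exchanged. *)
Lemma pressure_denergy a b : 0 < b -> b < a ->
  b * (denergy gamma a - denergy gamma b) <= pressure gamma a - pressure gamma b
    <= a * (denergy gamma a - denergy gamma b).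
Proof.
move=> b0 ba; have a0 := lt_trans b0 ba.
have g1 : 0 < gamma - 1 by rewrite subr_gt0.
rewrite !denergyE// /pressure -mulrBr.
have := young (ltW a0) (ltW b0); have := young (ltW b0) (ltW a0).
rewrite (powR_gammaE (ltW a0)) (powR_gammaE (ltW b0)) => h1 h2.
have E x : x * (gamma / (gamma - 1) * (a `^ (gamma - 1) - b `^ (gamma - 1))) =
   (x * gamma * (a `^ (gamma - 1) - b `^ (gamma - 1))) / (gamma - 1) by field; lra.
by rewrite !E ler_pdivrMr// ler_pdivlMr//; apply/andP; split; lra.
Qed.

Lemma interface_valueP a b : 0 < a -> 0 < b ->
  is_interface_value gamma a b (interface_value gamma a b).
Proof.
move=> a0 b0; apply: getPex; rewrite /is_interface_value.
case: (ltgtP a b) => ab.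
- have s0 := denergy_slope a0 ab; have /andP[h1 h2] := pressure_denergy a0 ab.
  exists ((pressure gamma b - pressure gamma a) / (denergy gamma b - denergy gamma a)).
  rewrite ler_pdivlMr// h1 ler_pdivrMr// h2; split => //.
  by rewrite -(opprB (denergy gamma b)) mulrN divfK ?gt_eqF// opprB.
- have s0 := denergy_slope b0 ab; have /andP[h1 h2] := pressure_denergy b0 ab.
  exists ((pressure gamma a - pressure gamma b) / (denergy gamma a - denergy gamma b)).
  rewrite ler_pdivlMr// h1 ler_pdivrMr// h2; split => //.
  by rewrite divfK ?gt_eqF.
- by exists a; rewrite ab lexx.
Qed.

Lemma interface_between a b : 0 < a -> 0 < b ->
  Num.min a b <= interface_value gamma a b <= Num.max a b.
Proof. by move=> a0 b0; have [] := interface_valueP a0 b0. Qed.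

Lemma interface_eq a b : 0 < a -> 0 < b ->
  pressure gamma a - pressure gamma b =
  interface_value gamma a b * (denergy gamma a - denergy gamma b).
Proof.
move=> a0 b0; have [_] := interface_valueP a0 b0.
by case: eqP => // -> _; rewrite !subrr mulr0.
Qed.

Lemma interface_gt0 a b : 0 < a -> 0 < b -> 0 < interface_value gamma a b.
Proof.
move=> a0 b0; have /andP[h _] := interface_between a0 b0.
by rewrite (lt_le_trans _ h)// lt_min a0.
Qed.

(** The interface value does not degenerate when only one of the two densities
    does: if [y < x] then [x `^ gamma - y `^ gamma] is at least
    [x * (x `^ (gamma - 1) - y `^ (gamma - 1))]. *)
Lemma interface_ge a b : 0 < a -> 0 < b ->
  (gamma - 1) / gamma * Num.max a b <= interface_value gamma a b.
Proof.
have g0 : 0 < gamma by rewrite (lt_trans ltr01).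
have g1 : 0 < gamma - 1 by rewrite subr_gt0.
have key x y c : 0 < y -> y < x -> pressure gamma x - pressure gamma y =
    c * (denergy gamma x - denergy gamma y) -> (gamma - 1) / gamma * x <= c.
  move=> y0 yx; have x0 := lt_trans y0 yx.
  have s0 := denergy_slope y0 yx => E.
  rewrite -(ler_pM2r s0) -E !denergyE// /pressure (powR_gammaE (ltW x0)) (powR_gammaE (ltW y0)) -mulrBr.
  have -> : (gamma - 1) / gamma * x * (gamma / (gamma - 1) *
      (x `^ (gamma - 1) - y `^ (gamma - 1))) =
      x * (x `^ (gamma - 1) - y `^ (gamma - 1)) by field; lra.
  by rewrite mulrBr lerB// ler_pM2r ?ltW// powR_gt0.
move=> a0 b0; have E := interface_eq a0 b0.
case: (ltgtP a b) => ab.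
- apply: (key _ a) => //; rewrite -[LHS]opprB E; ring.
- exact: (key _ b).
- have /andP[+ _] := interface_between a0 b0; rewrite ab minxx; apply: le_trans.
  by rewrite ler_piMl ?(ltW b0)// ler_pdivrMr// mul1r gerBl.
Qed.

(** At equal limits the quotient that defines the interface value degenerates,
    but the value is squeezed between its two arguments. *)
Lemma interface_cvg (f g : nat -> R) a b : 0 < a -> 0 < b ->
  f @ \oo --> a -> g @ \oo --> b ->
  (fun k => interface_value gamma (f k) (g k)) @ \oo --> interface_value gamma a b.
Proof.
move=> a0 b0 fa gb.
have f0 : \forall k \near \oo, 0 < f k by apply: (cvgr_gt a).
have g0 : \forall k \near \oo, 0 < g k by apply: (cvgr_gt b).
have [ab|ab] := eqVneq a b.
  have iv : interface_value gamma a b = a.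
    have /andP[] := interface_between a0 b0; rewrite -ab minxx maxxx => ? ?.
    by apply/eqP; rewrite eq_le; apply/andP.
  rewrite iv; apply: (@squeeze_cvgr _ _ _ _ (fun k => Num.min (f k) (g k))
    (fun k => Num.max (f k) (g k))).
  - by near=> k; apply: interface_between; near: k.
  - by rewrite -[X in _ --> X]minxx {2}ab; exact: cvg_minr.
  - by rewrite -[X in _ --> X]maxxx {2}ab; exact: cvg_maxr.
have slope x y : 0 < x -> 0 < y -> x != y ->
    denergy gamma x - denergy gamma y != 0.
  move=> x0 y0; rewrite subr_eq0 neq_lt => /orP[xy|xy].
    by rewrite lt_eqF// denergy_mono.
  by rewrite gt_eqF// denergy_mono.
have ivE x y : 0 < x -> 0 < y -> x != y -> interface_value gamma x y =
    (pressure gamma x - pressure gamma y) / (denergy gamma x - denergy gamma y).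
  by move=> x0 y0 xy; rewrite interface_eq// mulfK// slope.
rewrite ivE//.
apply: (@cvg_trans _ ((fun k => (pressure gamma (f k) - pressure gamma (g k)) /
    (denergy gamma (f k) - denergy gamma (g k))) @ \oo)).
  apply: near_eq_cvg; near=> k; rewrite ivE//; [by near: k|by near: k|].
  rewrite -subr_eq0; near: k; apply: (cvgr_neq0 (a - b)); last by rewrite subr_eq0.
  exact: cvgB.
apply: cvgM; first by apply: cvgB; exact: powR_cvg.
by apply: cvgV; [exact: slope|apply: cvgB; exact: denergy_cvg].
Unshelve. all: by end_near. Qed.

End interface_density.

(** * Limits of the discrete operators *)

Section discrete_limits.
Variables (R : realType) (d : nat) (Omega : set 'rV[R]_d) (M : mac_grid Omega).
Variable gamma : R.
Hypothesis gamma_gt1 : 1 < gamma.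
Implicit Types (K L : cell M) (sigma : face M) (rho : nat -> cfun M)
  (v w : nat -> ffield M).

Lemma gradE (q : cfun M) sigma :
  grad q sigma = - (farea sigma / dual_volume sigma * jump q sigma).
Proof.
rewrite /grad ffunE /jump; case: cell_at => [K|]; last by rewrite mulr0 oppr0.
by case: cell_at => [L|]; rewrite ?mulr0 ?oppr0// -mulrN opprB.
Qed.

Lemma face_densityE (rho : cfun M) sigma K L : cell_at sigma true = Some K ->
  cell_at sigma false = Some L ->
  face_density gamma rho sigma = interface_value gamma (rho K) (rho L).
Proof. by move=> hK hL; rewrite /face_density hK hL. Qed.

Lemma div_fluxE (rho : cfun M) (v : ffield M) K : div_flux gamma rho v K =
  (volume (cbx K))^-1 *
  outflow (fun sigma => farea sigma * face_density gamma rho sigma * v sigma) K.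
Proof.
congr (_ * _); apply: eq_bigr => i _; apply: eq_bigr => s _.
by rewrite /flux; case: ifP => // _; rewrite mulrA.
Qed.

Lemma dual_avgE (rho : cfun M) sigma K L : cell_at sigma true = Some K ->
  cell_at sigma false = Some L -> dual_avg rho sigma =
  (half_volume sigma true * rho K + half_volume sigma false * rho L) /
  (half_volume sigma true + half_volume sigma false).
Proof. by move=> hK hL; rewrite /dual_avg /dual_volume !big_bool/= hK hL. Qed.

Lemma dual_avg_le_max (rho : cfun M) sigma K L : cell_at sigma true = Some K ->
  cell_at sigma false = Some L -> dual_avg rho sigma <= Num.max (rho K) (rho L).
Proof.
move=> hK hL; rewrite (dual_avgE _ hK hL).
have is_int : internal sigma by rewrite /internal hK hL.
have h1 := half_volume_gt0 true is_int; have h2 := half_volume_gt0 false is_int.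
rewrite ler_pdivrMr ?addr_gt0// [leRHS]mulrC mulrDl.
by rewrite lerD// ler_wpM2l ?(ltW h1) ?(ltW h2)// le_max lexx ?orbT.
Qed.

Lemma dual_avg_gt0 (rho : cfun M) sigma : (forall K, 0 < rho K) ->
  internal sigma -> 0 < dual_avg rho sigma.
Proof.
move=> rho0 is_int; have [K [L [hK hL]]] := internalP is_int.
have h1 := half_volume_gt0 true is_int; have h2 := half_volume_gt0 false is_int.
by rewrite (dual_avgE _ hK hL) divr_gt0 ?addr_gt0// mulr_gt0.
Qed.

Section limits.
Variables (rho : nat -> cfun M) (rhot : cfun M).
Hypothesis rhot_gt0 : forall K, 0 < rhot K.
Hypothesis rho_cvg : forall K, (fun k => rho k K) @ \oo --> rhot K.

Lemma dual_avg_cvg sigma :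
  (fun k => dual_avg (rho k) sigma) @ \oo --> dual_avg rhot sigma.
Proof.
apply: cvgM; last exact: cvg_cst.
apply: cvg_bigsum => s _; apply: cvgM; first exact: cvg_cst.
by case: cell_at => [K|]; [exact: rho_cvg|exact: cvg_cst].
Qed.

Lemma face_density_cvg sigma : internal sigma ->
  (fun k => face_density gamma (rho k) sigma) @ \oo --> face_density gamma rhot sigma.
Proof.
move=> /internalP[K [L [hK hL]]]; rewrite (face_densityE _ hK hL).
under eq_fun do rewrite (face_densityE _ hK hL).
exact: interface_cvg.
Qed.

Lemma face_density_gt0 sigma : internal sigma -> 0 < face_density gamma rhot sigma.
Proof.
move=> /internalP[K [L [hK hL]]]; rewrite (face_densityE _ hK hL).
exact: interface_gt0.
Qed.

Lemma outflow_cvg (G : nat -> face M -> R) (H : face M -> R) K :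
  (forall sigma, internal sigma -> (fun k => G k sigma) @ \oo --> H sigma) ->
  (fun k => outflow (G k) K) @ \oo --> outflow H K.
Proof.
move=> GH; apply: cvg_bigsum => i _; apply: cvg_bigsum => s _.
case: ifP => [/GH h|_]; last exact: cvg_cst.
by apply: cvgM => //; exact: cvg_cst.
Qed.

Lemma outflow_bounded (G : nat -> face M -> R) K :
  (forall sigma, internal sigma -> ev_bounded (fun k => G k sigma)) ->
  ev_bounded (fun k => outflow (G k) K).
Proof.
move=> GB; apply: ev_bounded_sum => i _; apply: ev_bounded_sum => s _.
case: (boolP (internal (side K i s))) => [/GB h|_];
  last exact: (@ev_bounded_cvg _ _ 0 (cvg_cst _)).
by apply: ev_boundedM => //; exact: (ev_bounded_cvg (cvg_cst _)).
Qed.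

Variables (v w : nat -> ffield M) (V W : ffield M).
Hypothesis v_cvg : forall sigma, internal sigma ->
  (fun k => v k sigma) @ \oo --> V sigma.
Hypothesis w_cvg : forall sigma, (fun k => w k sigma) @ \oo --> W sigma.

Lemma div_flux_cvg K :
  (fun k => div_flux gamma (rho k) (v k) K) @ \oo --> div_flux gamma rhot V K.
Proof.
rewrite div_fluxE; under eq_fun do rewrite div_fluxE.
apply: cvgM; first exact: cvg_cst.
apply: outflow_cvg => sigma hs; apply: cvgM; last exact: v_cvg.
by apply: cvgM; [exact: cvg_cst|exact: face_density_cvg].
Qed.

Lemma flux_cvg K i s :
  (fun k => flux gamma (rho k) (v k) K i s) @ \oo --> flux gamma rhot V K i s.
Proof.
rewrite /flux; case: ifP => [hs|_]; last exact: cvg_cst.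
apply: cvgM; first by apply: cvgM; [exact: cvg_cst|exact: face_density_cvg].
by apply: cvgM; [exact: v_cvg|exact: cvg_cst].
Qed.

Lemma dual_flux_cvg sigma j t :
  (fun k => dual_flux gamma (rho k) (v k) sigma j t) @ \oo -->
  dual_flux gamma rhot V sigma j t.
Proof.
rewrite /dual_flux; case: ifP => _.
  case: cell_at => [K|]; last exact: cvg_cst.
  by apply: cvgM; [apply: cvgB; exact: flux_cvg|exact: cvg_cst].
apply: cvgM; last exact: cvg_cst.
apply: cvg_bigsum => s _; case: cell_at => [K|]; last exact: cvg_cst.
exact: flux_cvg.
Qed.

(** The upwind value jumps where the flux changes sign, but its product with
    the flux does not. *)
Lemma upwind_maxmin (z : ffield M) sigma j t (F : R) :
  F * upwind z sigma j t F = Num.max F 0 * z sigma +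
    Num.min F 0 * (if dual_neighbour sigma j t is Some sigma' then z sigma' else 0).
Proof.
rewrite /upwind; case: ifPn => F0; first by rewrite max_l// min_r// mul0r addr0.
by rewrite -ltNge in F0; rewrite max_r ?min_l ?ltW// mul0r add0r.
Qed.

Lemma convection_cvg sigma :
  (fun k => convection gamma (rho k) (v k) (w k) sigma) @ \oo -->
  convection gamma rhot V W sigma.
Proof.
apply: cvgM; first exact: cvg_cst.
apply: cvg_bigsum => j _; apply: cvg_bigsum => t _.
rewrite upwind_maxmin; under eq_fun do rewrite upwind_maxmin.
have F_cvg := @dual_flux_cvg sigma j t.
apply: cvgD; apply: cvgM => //.
- by apply: cvg_maxr => //; exact: cvg_cst.
- by apply: cvg_minr => //; exact: cvg_cst.
- by case: dual_neighbour => [sigma'|]; [exact: w_cvg|exact: cvg_cst].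
Qed.

End limits.

(** If [h \o q k] differs from [h \o qt] by almost a constant and the masses
    almost agree, then that constant is small: otherwise [q k - qt] would have
    the same sign in every cell. *)
Lemma cvg_of_monotone_jumps (h : R -> R) (q : nat -> cfun M)
    (qt : cfun M) :
  (forall a b, 0 < a -> 0 < b -> a < b -> h a < h b) ->
  (forall K, 0 < qt K) -> (forall k K, 0 < q k K) ->
  (forall K L, (fun k => (h (q k K) - h (qt K)) -
     (h (q k L) - h (qt L))) @ \oo --> 0) ->
  (fun k => \sum_K volume (cbx K) * (q k K - qt K)) @ \oo --> 0 ->
  forall K, (fun k => q k K) @ \oo --> qt K.
Proof.
move=> h_mono qt0 q0 zjump mass K.
have mono a b : 0 < a -> 0 < b -> h a <= h b -> a <= b.
  move=> a0 b0; rewrite leNgt => hab; rewrite leNgt; apply/negP => ba.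
  by move/negP: hab; apply; exact: h_mono.
apply/cvgrPdist_lt => e e0.
pose d' := Num.min e (qt K / 2).
have d'0 : 0 < d' by rewrite lt_min e0 divr_gt0.
have d'q : 0 < qt K - d'.
  rewrite subr_gt0 (@le_lt_trans _ _ (qt K / 2)) ?ge_min ?lexx ?orbT//.
  by rewrite ltr_pdivrMr// ltr_pMr// ltr1n.
pose a := h (qt K + d') - h (qt K).
pose b := h (qt K) - h (qt K - d').
have a0 : 0 < a by rewrite subr_gt0 h_mono ?addr_gt0// ltrDl.
have b0 : 0 < b by rewrite subr_gt0 h_mono// gtrBl.
have vK := volume_gt0 K.
have zj c : 0 < c -> \forall k \near \oo, forall L,
   `|(h (q k K) - h (qt K)) -
     (h (q k L) - h (qt L))| < c.
  move=> c0; apply: (@filter_forall _ _ (fun L k => `|_ - (h (q k L) - _)| < c)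
    \oo _) => L.
  by have /cvgr0Pnorm_lt := zjump K L; exact.
near=> k.
have zja : forall L, `|(h (q k K) - h (qt K)) -
     (h (q k L) - h (qt L))| < a by near: k; exact: zj.
have zjb : forall L, `|(h (q k K) - h (qt K)) -
     (h (q k L) - h (qt L))| < b by near: k; exact: zj.
have small : `|\sum_K volume (cbx K) * (q k K - qt K)| < volume (cbx K) * d'.
  by near: k; have /cvgr0Pnorm_lt := mass; apply; rewrite mulr_gt0.
have part (P : cfun M) : (forall L, 0 <= volume (cbx L) * P L) ->
    volume (cbx K) * P K <= \sum_L volume (cbx L) * P L.
  by move=> P0; rewrite (bigD1 K)//= lerDl sumr_ge0.
rewrite (@lt_le_trans _ _ d')// ?ge_min ?lexx// distrC ltr_norml; apply/andP; split.
- rewrite ltNge; apply/negP => far.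
  have zK : h (q k K) <= h (qt K - d').
    have := far; rewrite lerBlDr addrC le_eqVlt => /predU1P[->//|hlt].
    by apply/ltW/h_mono.
  have sgn_ L : 0 <= volume (cbx L) * [ffun L => qt L - q k L] L.
    rewrite ffunE; apply: mulr_ge0; first exact/ltW/volume_gt0.
    rewrite subr_ge0; apply: mono; [exact: q0|exact: qt0|].
    by have := zjb L; rewrite ltr_norml /b => /andP[]; lra.
  have := part _ sgn_; rewrite ffunE.
  have -> : \sum_L volume (cbx L) * [ffun L => qt L - q k L] L =
      - \sum_K volume (cbx K) * (q k K - qt K).
    by rewrite -sumrN; apply: eq_bigr => L _; rewrite ffunE -mulrN opprB.
  move: small; rewrite ltr_norml => /andP[s1 s2] s3.
  have : volume (cbx K) * d' <= volume (cbx K) * (qt K - q k K).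
    by rewrite ler_wpM2l ?(ltW vK)//; lra.
  by lra.
- rewrite ltNge; apply/negP => far.
  have zK : h (qt K + d') <= h (q k K).
    have := far; rewrite lerBrDr addrC le_eqVlt => /predU1P[->//|hlt].
    by apply/ltW/h_mono => //; rewrite addr_gt0.
  have sgn_ L : 0 <= volume (cbx L) * [ffun L => q k L - qt L] L.
    rewrite ffunE; apply: mulr_ge0; first exact/ltW/volume_gt0.
    rewrite subr_ge0; apply: mono; [exact: qt0|exact: q0|].
    by have := zja L; rewrite ltr_norml /a => /andP[]; lra.
  have := part _ sgn_; rewrite ffunE.
  have -> : \sum_L volume (cbx L) * [ffun L => q k L - qt L] L =
      \sum_K volume (cbx K) * (q k K - qt K).
    by apply: eq_bigr => L _; rewrite ffunE.
  move: small; rewrite ltr_norml => /andP[s1 s2] s3.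
  have : volume (cbx K) * d' <= volume (cbx K) * (q k K - qt K).
    by rewrite ler_wpM2l ?(ltW vK).
  by lra.
Unshelve. all: by end_near. Qed.

End discrete_limits.

(** * Passage to the limit in one time step *)

(** [r], [w] and [r1], [w1] are the densities and velocities at the old and the
    new time level, indexed by the member of the sequence. *)

Section one_step.
Variables (R : realType) (d : nat) (Omega : set 'rV[R]_d) (M : mac_grid Omega).
Hypotheses (openO : open Omega) (connO : connected Omega).
Variables (gamma dt eta1 C : R).
Hypotheses (gamma_gt1 : 1 < gamma) (dt_gt0 : 0 < dt) (eta1_gt0 : 0 < eta1).
Variable eps : nat -> R.
Hypotheses (eps_gt0 : forall k, 0 < eps k) (eps_cvg : eps @ \oo --> 0).
Variable rhot : cfun M.
Hypothesis rhot_gt0 : forall K, 0 < rhot K.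
Let phi : cfun M := [ffun K => C - denergy gamma (rhot K)].
Variables (r r1 : nat -> cfun M) (w w1 : nat -> ffield M) (W : ffield M).
Hypotheses (r_cvg : forall K, (fun k => r k K) @ \oo --> rhot K)
  (w_cvg : forall sigma, (fun k => w k sigma) @ \oo --> W sigma)
  (r1_gt0 : forall k K, 0 < r1 k K)
  (step : forall k,
    scheme_step gamma dt (eps k) eta1 phi (r k) (r1 k) (w k) (w1 k))
  (ratio : forall k sigma, internal sigma ->
    dual_avg (r k) sigma / dual_avg (r1 k) sigma <= 3 / 2).
Arguments r_cvg : clear implicits.
Arguments w_cvg : clear implicits.

(** The deviation of the enthalpy from equilibrium, on the scale [eps ^+ 2] of
    the pressure of the limit scheme, to which it converges up to a constant. *)
Let x k : cfun M :=
  [ffun K => (eps k ^+ 2)^-1 * (denergy gamma (r1 k K) - denergy gamma (rhot K))].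
Let fd k sigma := face_density gamma (r1 k) sigma.
Let et k sigma := eta_stab eta1 (r k) sigma.
Let a k sigma := farea sigma * fd k sigma *
  (et k sigma * dt * (fd k sigma * (farea sigma / dual_volume sigma))).

(** The interface density is chosen so that pressure and potential combine into
    a multiple of the gradient of [h'(rho) - h'(rhot)]. *)
Let force k sigma : internal sigma ->
  (eps k ^+ 2)^-1 * (grad (pressure_M gamma (r1 k)) sigma
    + fd k sigma * grad phi sigma) = fd k sigma * grad (x k) sigma.
Proof.
move=> /internalP[K [L [hK hL]]].
rewrite /fd !gradE !(jumpE _ hK hL) !ffunE.
rewrite (interface_eq gamma_gt1 (r1_gt0 k K) (r1_gt0 k L)) (face_densityE _ _ hK hL).
move: (_ / _) (_ ^-1) (interface_value _ _ _) => c e i.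
move: (denergy _ (r1 k K)) (denergy _ (r1 k L)) => h1 h2.
by move: (denergy _ (rhot K)) (denergy _ (rhot L)) => h3 h4; ring.
Qed.

Let correctionE k sigma : internal sigma ->
  correction gamma dt (eps k) eta1 phi (r k) (r1 k) sigma =
  et k sigma * dt * (fd k sigma * grad (x k) sigma).
Proof. by move=> hs; rewrite ffunE hs -(force k hs) [RHS]mulrA. Qed.

Let v k := w k - correction gamma dt (eps k) eta1 phi (r k) (r1 k).

Let vE k sigma : internal sigma ->
  v k sigma = w k sigma - et k sigma * dt * (fd k sigma * grad (x k) sigma).
Proof. by move=> hs; rewrite -(correctionE k hs) /v [LHS]ffunE [X in _ + X]ffunE. Qed.

Let mass_balance k K : outflow (fun sigma => farea sigma * fd k sigma * v k sigma) K =
  - (volume (cbx K) / dt * (r1 k K - r k K)).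
Proof.
have [/(_ K) + _] := step k; rewrite div_fluxE -/(v k).
move=> /(congr1 (fun z => volume (cbx K) * z)).
rewrite mulr0 mulrDr (mulrA (volume _) (volume _)^-1) divff ?gt_eqF ?volume_gt0//.
by rewrite mul1r addrC mulrA => /eqP; rewrite addr_eq0 => /eqP.
Qed.

(** The correction contained in [v k] is a multiple of the gradient of [x k];
    moved to the left, it turns the mass balance into an elliptic equation. *)
Let elliptic_eq k K : outflow (fun sigma => a k sigma * jump (x k) sigma) K =
  - (volume (cbx K) / dt * (r1 k K - r k K))
  - outflow (fun sigma => farea sigma * fd k sigma * w k sigma) K.
Proof.
rewrite -mass_balance outflowB; apply: eq_outflow => sigma hs.
by rewrite vE// gradE /a; ring.
Qed.

Let total_mass k : \sum_K volume (cbx K) * r1 k K = \sum_K volume (cbx K) * r k K.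
Proof.
have := sum_outflow0 (fun sigma => farea sigma * fd k sigma * v k sigma).
under eq_bigr do rewrite mass_balance.
rewrite sumrN => /eqP; rewrite oppr_eq0.
have -> : \sum_K volume (cbx K) / dt * (r1 k K - r k K) =
    dt^-1 * (\sum_K volume (cbx K) * r1 k K - \sum_K volume (cbx K) * r k K).
  by rewrite -sumrB mulr_sumr; apply: eq_bigr => K _; ring.
by rewrite mulf_eq0 invr_eq0 gt_eqF//= subr_eq0 => /eqP.
Qed.

(** By positivity, each cell carries at most the conserved total mass. *)
Let r1_bounded K : ev_bounded (fun k => r1 k K).
Proof.
have [B hB] : ev_bounded (fun k => \sum_K volume (cbx K) * r k K).
  apply: ev_bounded_sum => L _; apply: ev_boundedM.
    exact: ev_bounded_cvg (cvg_cst _).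
  exact: ev_bounded_cvg (r_cvg L).
exists ((volume (cbx K))^-1 * B); near=> k.
rewrite ger0_norm ?(ltW (r1_gt0 _ _))// ler_pdivlMl ?volume_gt0//.
apply: (@le_trans _ _ `|\sum_K volume (cbx K) * r k K|); last by near: k.
rewrite -total_mass (le_trans _ (ler_norm _))// (bigD1 K)//= lerDl sumr_ge0// => L _.
by rewrite mulr_ge0// ltW// volume_gt0.
Unshelve. all: by end_near. Qed.

Let fd_bounded sigma : internal sigma -> ev_bounded (fun k => fd k sigma).
Proof.
move=> /internalP[K [L [hK hL]]].
have [B hB] := ev_boundedD (r1_bounded K) (r1_bounded L).
exists B; near=> k; apply: (@le_trans _ _ `|r1 k K + r1 k L|); last by near: k.
rewrite /fd (face_densityE _ _ hK hL).
have /andP[_ h] := interface_between gamma_gt1 (r1_gt0 k K) (r1_gt0 k L).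
rewrite ger0_norm ?(ltW (interface_gt0 _ _ _))// (le_trans h)//.
rewrite ger0_norm; last by rewrite addr_ge0// ltW.
by rewrite ge_max lerDl lerDr !ltW.
Unshelve. all: by end_near. Qed.

(** The stability condition keeps the density of every dual cell away from
    zero, hence also its interface density. *)
Let fd_pos sigma : internal sigma -> ev_pos (fun k => fd k sigma).
Proof.
move=> hs; have [K [L [hK hL]]] := internalP hs.
have g0 : 0 < (gamma - 1) / gamma.
  by rewrite divr_gt0 ?subr_gt0// (lt_trans ltr01).
pose c := (gamma - 1) / gamma * (3 / 2)^-1.
have c0 : 0 < c by rewrite mulr_gt0// invr_gt0 divr_gt0.
apply: (@ev_pos_ge _ (fun k => c * dual_avg (r k) sigma)).
  apply: ev_posM; first by exists c => //; exact: nearW.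
  exact: ev_pos_cvg (dual_avg_gt0 rhot_gt0 hs) (dual_avg_cvg r_cvg (sigma := sigma)).
apply: nearW => k; rewrite /fd (face_densityE _ _ hK hL).
apply: le_trans (interface_ge gamma_gt1 (r1_gt0 k K) (r1_gt0 k L)).
rewrite /c -mulrA ler_wpM2l ?(ltW g0)//.
apply: le_trans (dual_avg_le_max (r1 k) hK hL).
rewrite ler_pdivrMl ?divr_gt0//.
by have := ratio k hs; rewrite ler_pdivrMr// dual_avg_gt0.
Qed.

Let et_cvg sigma : internal sigma ->
  (fun k => et k sigma) @ \oo --> eta1 / dual_avg rhot sigma.
Proof.
move=> hs; apply: cvgM; first exact: cvg_cst.
apply: cvgV; last exact: dual_avg_cvg.
by rewrite gt_eqF// dual_avg_gt0.
Qed.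

Let a_pos sigma : internal sigma -> ev_pos (fun k => a k sigma).
Proof.
move=> hs; have cst c : 0 < c -> ev_pos (fun _ : nat => c).
  by move=> c0; exists c => //; exact: nearW.
have fs := fd_pos hs; have es := ev_pos_cvg _ (et_cvg hs).
have f0 := farea_gt0 hs; have v0 := dual_volume_gt0 hs.
apply: ev_posM; first by apply: ev_posM => //; exact: cst.
apply: ev_posM; last by apply: ev_posM => //; apply: cst; rewrite divr_gt0.
by apply: ev_posM; [apply: es; rewrite divr_gt0// dual_avg_gt0|exact: cst].
Qed.

(** The right-hand side of [elliptic_eq] is merely bounded at this point, since
    the density increment is not yet known to be small. *)
Let x_bounded K L : ev_bounded (fun k => x k K - x k L).
Proof.
have [a0 a0_gt0 aP] := ev_pos_all a_pos.
have [c c0 cP] := @elliptic_estimate _ _ _ M a0 openO connO a0_gt0.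
have [B hB] : ev_bounded (fun k =>
    \sum_K' `|outflow (fun sigma => a k sigma * jump (x k) sigma) K'|).
  apply: ev_bounded_sum => K' _.
  suff [B hB] : ev_bounded (fun k =>
      outflow (fun sigma => a k sigma * jump (x k) sigma) K').
    by exists B; near=> k; rewrite normr_id; near: k.
  rewrite (_ : (fun _ => _) = (fun k => - (volume (cbx K') / dt * (r1 k K' - r k K'))
    - outflow (fun sigma => farea sigma * fd k sigma * w k sigma) K')); last first.
    by apply/funext => k; exact: elliptic_eq.
  have rB := ev_bounded_cvg (r_cvg K').
  apply: ev_boundedD; apply: ev_boundedN.
    apply: ev_boundedM; first exact: ev_bounded_cvg (cvg_cst _).
    by apply: ev_boundedD => //; exact: ev_boundedN.
  apply: outflow_bounded => sigma hs.
  apply: ev_boundedM; last exact: ev_bounded_cvg (w_cvg sigma).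
  by apply: ev_boundedM; [exact: ev_bounded_cvg (cvg_cst _)|exact: fd_bounded].
exists (c * B); near=> k; apply: (le_trans (cP (a k) (x k) K L _)).
  by near: k.
rewrite ler_wpM2l//; apply: (le_trans (ler_norm _)); near: k; exact: hB.
Unshelve. all: by end_near. Qed.

(** The jumps of [h'(r1) - h'(rhot)] are those of [x] multiplied by [eps ^+ 2],
    and the total mass is that of the converging sequence [r]. *)
Lemma next_density_cvg K : (fun k => r1 k K) @ \oo --> rhot K.
Proof.
apply: (cvg_of_monotone_jumps (denergy_mono gamma_gt1) rhot_gt0 r1_gt0) => [K' L|].
  rewrite (_ : (fun _ => _) = (fun k => eps k ^+ 2 * (x k K' - x k L))); last first.
    apply/funext => k; rewrite /x !ffunE -mulrBr.
    by rewrite (mulrA (eps k ^+ 2) (eps k ^+ 2)^-1) divff ?expf_neq0 ?gt_eqF// mul1r.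
  apply: cvg0_bounded (x_bounded K' L).
  by rewrite -(mulr0 0); exact: cvgM.
rewrite (_ : (fun _ => _) = (fun k => \sum_K' volume (cbx K') * (r k K' - rhot K'))).
  apply: cvg_bigsum0 => K' _; rewrite -(mulr0 (volume (cbx K'))).
  by apply: cvgM; [exact: cvg_cst|exact: dist0_of_cvg].
apply/funext => k; under eq_bigr do rewrite mulrBr.
under [RHS]eq_bigr do rewrite mulrBr.
by rewrite !sumrB total_mass.
Qed.

Arguments next_density_cvg : clear implicits.

Let fd_cvg sigma (hs : internal sigma) :=
  face_density_cvg gamma_gt1 rhot_gt0 next_density_cvg hs.

Let al sigma := farea sigma * face_density gamma rhot sigma *
  (eta1 / dual_avg rhot sigma * dt *
    (face_density gamma rhot sigma * (farea sigma / dual_volume sigma))).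

Let a_cvg sigma : internal sigma -> (fun k => a k sigma) @ \oo --> al sigma.
Proof.
move=> hs; apply: cvgM.
  by apply: cvgM; [exact: cvg_cst|exact: fd_cvg].
apply: cvgM; last by apply: cvgM; [exact: fd_cvg|exact: cvg_cst].
by apply: cvgM; [exact: et_cvg|exact: cvg_cst].
Qed.

(** Replacing the coefficients [a k] by their limits [al] costs [al - a k],
    which tends to zero, times the bounded jumps of [x k]. *)
Let residual_cvg K : (fun k => outflow (fun sigma => al sigma * jump (x k) sigma) K)
  @ \oo --> - outflow (fun sigma =>
    farea sigma * face_density gamma rhot sigma * W sigma) K.
Proof.
rewrite (_ : (fun _ => _) = (fun k => (- (volume (cbx K) / dt * (r1 k K - r k K))
    - outflow (fun sigma => farea sigma * fd k sigma * w k sigma) K) +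
    outflow (fun sigma => (al sigma - a k sigma) * jump (x k) sigma) K)); last first.
  apply/funext => k; rewrite -elliptic_eq; apply/eqP.
  rewrite addrC -subr_eq outflowB; apply/eqP/eq_outflow => sigma _.
  by rewrite /=; ring.
rewrite -[X in _ --> X]addr0; apply: cvgD.
  rewrite -[X in _ --> X]add0r; apply: cvgB.
    rewrite -oppr0; apply: cvgN; rewrite -(mulr0 (volume (cbx K) / dt)).
    apply: cvgM; first exact: cvg_cst.
    by rewrite -(subrr (rhot K)); apply: cvgB => //; exact: next_density_cvg.
  apply: (outflow_cvg (G := fun k sigma => farea sigma * fd k sigma * w k sigma)).
  move=> sigma hs; apply: cvgM; last exact: w_cvg.
  by apply: cvgM; [exact: cvg_cst|exact: fd_cvg].
have -> : 0 = outflow (fun _ : face M => 0) K :> R.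
  by rewrite /outflow big1// => i _; rewrite big1// => s _; case: ifP; rewrite ?mul0r.
apply: (outflow_cvg (G := fun k sigma => (al sigma - a k sigma) * jump (x k) sigma)).
move=> sigma hs; apply: cvg0_bounded.
  rewrite -(subrr (al sigma)); apply: cvgB; [exact: cvg_cst|exact: a_cvg].
have [K' [L [hK hL]]] := internalP hs.
by under eq_fun do rewrite (jumpE _ hK hL); exact: x_bounded.
Qed.

Let al_gt0 sigma : internal sigma -> 0 < al sigma.
Proof.
move=> hs; have f0 := farea_gt0 hs; have v0 := dual_volume_gt0 hs.
have d0 := dual_avg_gt0 rhot_gt0 hs; have i0 := face_density_gt0 gamma_gt1 rhot_gt0 hs.
by rewrite /al; do ?apply: mulr_gt0; rewrite ?invr_gt0.
Qed.

Lemma pressure_limit : exists p : cfun M, forall sigma, internal sigma ->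
  (fun k => grad (x k) sigma) @ \oo --> grad p sigma.
Proof.
have [p pP] := elliptic_cvg openO connO al_gt0 residual_cvg.
exists p => sigma hs; rewrite gradE; under eq_fun do rewrite gradE.
by apply: cvgN; apply: cvgM; [exact: cvg_cst|exact: pP].
Qed.

(** Every term of the two equations now converges; the momentum equation is
    solved for the new velocity, as the dual densities stay positive. *)
Theorem limit_of_step (w1_H0 : forall k, H0 (w1 k)) :
  exists (p : cfun M) (W1 : ffield M),
    limit_step gamma dt (fun sigma => eta1 / dual_avg rhot sigma) rhot p W W1 /\
    forall sigma, (fun k => w1 k sigma) @ \oo --> W1 sigma.
Proof.
have [p pP] := pressure_limit.
pose dW : ffield M := [ffun sigma => if internal sigma then
  eta1 / dual_avg rhot sigma * dt *
    (face_density gamma rhot sigma * grad p sigma) else 0].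
pose W1 : ffield M := [ffun sigma => if internal sigma then
  W sigma - dt / dual_avg rhot sigma *
    (convection gamma rhot (W - dW) W sigma
      + face_density gamma rhot sigma * grad p sigma) else 0].
have v_cvg sigma : internal sigma -> (fun k => v k sigma) @ \oo --> (W - dW) sigma.
  move=> hs; have -> : (W - dW) sigma = W sigma - eta1 / dual_avg rhot sigma * dt *
      (face_density gamma rhot sigma * grad p sigma).
    by rewrite [LHS]ffunE [X in _ + X]ffunE [X in - X]ffunE hs.
  under eq_fun do rewrite vE//.
  apply: cvgB => //; apply: cvgM.
    by apply: cvgM; [exact: et_cvg|exact: cvg_cst].
  by apply: cvgM; [exact: fd_cvg|exact: pP].
exists p, W1; split; first split.
- move=> K; apply/esym/(@cvg_unique _ (@Rhausdorff R) ((fun k =>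
    div_flux gamma (r1 k) (v k) K) @ \oo)); last first.
    exact: (div_flux_cvg gamma_gt1 rhot_gt0 next_density_cvg v_cvg).
  rewrite (_ : (fun _ => _) = (fun k => - (dt^-1 * (r1 k K - r k K)))).
    rewrite -oppr0; apply: cvgN; rewrite -(mulr0 dt^-1).
    apply: cvgM; first exact: cvg_cst.
    by rewrite -(subrr (rhot K)); apply: cvgB => //; exact: next_density_cvg.
  apply/funext => k; have [/(_ K)/eqP + _] := step k.
  by rewrite addrC addr_eq0 => /eqP.
- move=> sigma hs; rewrite ffunE hs -/dW.
  have d0 := dual_avg_gt0 rhot_gt0 hs.
  by field; rewrite !gt_eqF.
- move=> sigma; rewrite ffunE; case: (boolP (internal sigma)) => hs; last first.
    rewrite (_ : (fun _ => _) = cst 0); first exact: cvg_cst.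
    by apply/funext => k; exact: w1_H0.
  have d0 := dual_avg_gt0 rhot_gt0 hs.
  rewrite (_ : (fun _ => _) = (fun k => (dual_avg (r1 k) sigma)^-1 *
      (dual_avg (r k) sigma * w k sigma - dt *
        (convection gamma (r1 k) (v k) (w k) sigma
         + fd k sigma * grad (x k) sigma)))); last first.
    apply/funext => k; have d1 := dual_avg_gt0 (r1_gt0 k) hs.
    have [_ /(_ _ hs)] := step k; rewrite -/(v k) -(force k hs) => E.
    apply: (@mulfI _ (dual_avg (r1 k) sigma)); first by rewrite gt_eqF.
    rewrite mulrA divff ?gt_eqF// mul1r.
    apply: (@mulfI _ dt^-1); first by rewrite invr_eq0 gt_eqF.
    rewrite (mulrBr dt^-1) (mulrA dt^-1 dt) mulVf ?gt_eqF// mul1r.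
    rewrite mulrBr in E; rewrite -/(fd k sigma) in E; lra.
  rewrite (_ : W sigma - _ = (dual_avg rhot sigma)^-1 *
      (dual_avg rhot sigma * W sigma - dt *
        (convection gamma rhot (W - dW) W sigma
         + face_density gamma rhot sigma * grad p sigma))); last first.
    by field; rewrite gt_eqF.
  apply: cvgM.
    by apply: cvgV; [rewrite gt_eqF|exact: (dual_avg_cvg next_density_cvg)].
  apply: cvgB; first by apply: cvgM; [exact: dual_avg_cvg|exact: w_cvg].
  apply: cvgM; first exact: cvg_cst.
  apply: cvgD.
    exact: (convection_cvg gamma_gt1 rhot_gt0 next_density_cvg v_cvg w_cvg).
  by apply: cvgM; [exact: fd_cvg|exact: pP].
Qed.

End one_step.

(** * Means of the data over cells and dual cells *)

Section rV_measure.
Variables (R : realType) (d : nat).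
Local Notation mu := (lebesgue_rV R d).
Implicit Types (A D : set 'rV[R]_d) (f g : 'rV[R]_d -> R).

Lemma measurable_obox (b : box R d) : measurable (obox b).
Proof.
rewrite obox_bigsetI; apply: bigsetI_measurable => j _; rewrite -[X in measurable X]setTI.
by apply: measurable_coord => //; exact: measurable_itv.
Qed.

(** An open set is the countable union of the boxes with rational corners that
    it contains. *)
Lemma open_measurable_rV D : open D -> measurable D.
Proof.
move=> oD.
pose B (ab : 'rV[rat]_d * 'rV[rat]_d) : box R d :=
  (map_mx ratr ab.1, map_mx ratr ab.2).
have -> : D = \bigcup_ab (if pselect (obox (B ab) `<=` D) then obox (B ab) else set0).
  apply/seteqP; split => x; last first.
    by move=> [ab _]; case: pselect => [h /h|h []].
  move=> Dx; have [e e0 eD] := open_rV_ball oD Dx.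
  have /fin_all_exists[p pP] : forall j : 'I_d, exists p : rat * rat,
      x 0 j - e < ratr p.1 < x 0 j /\ x 0 j < ratr p.2 < x 0 j + e.
    move=> j.
    have [p] := @rat_in_itvoo R (x 0 j - e) (x 0 j) (ltac:(by rewrite gtrBl)).
    have [q] := @rat_in_itvoo R (x 0 j) (x 0 j + e) (ltac:(by rewrite ltrDl)).
    by rewrite !in_itv/= => hq hp; exists (p, q).
  pose ab := (\row_j (p j).1, \row_j (p j).2); exists ab => //.
  case: pselect => [h|]; first move=> j.
    by rewrite !mxE; have [/andP[_ ->] /andP[-> _]] := pP j.
  case => y hy; apply: eD => j.
  have := hy j; rewrite !mxE; have [/andP[h1 h2] /andP[h3 h4]] := pP j.
  by move=> /andP[h5 h6]; rewrite ltr_norml; apply/andP; split; lra.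
apply: countable_bigcupT_measurable => [|ab]; first exact: countableP.
by case: pselect => h /=; [exact: measurable_obox|exact: measurable0].
Qed.

Lemma continuous_measurable_rV D f : open D ->
  (forall x, D x -> {for x, continuous f}) -> measurable_fun D f.
Proof.
move=> oD cf; apply: (measurability _ (RGenOpens.measurableE R)).
move=> _ [_ [a [b ->] <-]]; apply: open_measurable_rV.
rewrite openE => x [Dx fx]; apply: filterI; first exact: open_nbhs_nbhs.
by apply: (cf x Dx); apply: open_nbhs_nbhs; split => //; exact: interval_open.
Qed.

Lemma lebesgue_rV_setT_gt0 : (0 < mu setT)%E.
Proof.
pose b : box R d := (const_mx 0, const_mx 1).
apply: (@lt_le_trans _ _ (mu (cbox b))); last first.
  by apply: le_measure => //; rewrite inE//; exact: measurable_cbox.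
rewrite lebesgue_rV_cbox => [|j]; last by rewrite !mxE.
by rewrite lte_fin; apply: prodr_gt0 => j _; rewrite !mxE subr0.
Qed.

Lemma bounded_measure_lt_pinfty D : measurable D -> bounded_set D ->
  (mu D < +oo)%E.
Proof.
move=> mD [B0 [_ /(_ (B0 + 1))]]; rewrite ltrDl ltr01 => /(_ isT).
move: (B0 + 1) => B BP.
pose b : box R d := (const_mx (- `|B|), const_mx `|B|).
apply: (@le_lt_trans _ _ (mu (cbox b))).
  apply: le_measure; rewrite ?inE//; first exact: measurable_cbox.
  move=> x Dx j; rewrite !mxE -ler_norml.
  apply: le_trans (le_trans (BP x Dx) (ler_norm _)).
  have -> : `|x| = \big[Num.max/0]_ij `|x ij.1 ij.2| by exact: mx_normrE.
  exact: (le_bigmax _ (fun ij => `|x ij.1 ij.2|) (0, j)).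
rewrite lebesgue_rV_cbox ?ltry// => j; rewrite !mxE.
by rewrite (@le_trans _ _ 0)// oppr_le0.
Qed.

Lemma open_measure_gt0 D x : open D -> D x -> (0 < mu D)%E.
Proof.
move=> oD Dx; have [e e0 eD] := open_rV_ball oD Dx.
pose b : box R d := (\row_j (x 0 j - e / 2), \row_j (x 0 j + e / 2)).
apply: (@lt_le_trans _ _ (mu (cbox b))); last first.
  apply: le_measure; rewrite ?inE; [exact: measurable_cbox|exact: open_measurable_rV|].
  move=> y by_; apply: eD => j; have := by_ j; rewrite !mxE ltr_norml => /andP[h1 h2].
  by apply/andP; split; lra.
rewrite lebesgue_rV_cbox => [|j]; last by rewrite !mxE; lra.
by rewrite lte_fin; apply: prodr_gt0 => j _; rewrite !mxE; lra.
Qed.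

Section finite_measure_subset.
Variables (Omega A : set 'rV[R]_d).
Hypotheses (mOmega : measurable Omega) (mA : measurable A) (AO : A `<=` Omega)
  (Afin : (mu A < +oo)%E).

Lemma Linfty_ae g B : (normLp Omega +oo g <= B%:E)%E ->
  {ae mu, forall x, Omega x -> `|g x| <= B}.
Proof.
rewrite /normLp unlock /Lnorm.body ifT ?lebesgue_rV_setT_gt0//.
move=> /ess_supP; apply: filterS => x /= + Ox.
by rewrite /patch mem_set// lee_fin.
Qed.

Lemma Linfty_integral_le g B : in_Lp Omega +oo g -> (normLp Omega +oo g <= B%:E)%E ->
  mu.-integrable A (EFin \o g) /\
  `|\int[mu]_(x in A) g x| <= B * fine (mu A).
Proof.
move=> [mg _] gB.
have mgA : measurable_fun A g by exact: measurable_funS mg.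
have B0 : 0 <= B by rewrite -lee_fin (le_trans _ gB)// Lnorm_ge0.
have h : (\int[mu]_(x in A) `|(g x)%:E| <= B%:E * mu A)%E.
  apply: integral_le_bound => //; first exact/measurable_EFinP.
  by apply: filterS (Linfty_ae gB) => x /= gx Ax; rewrite lee_fin gx//; exact: AO.
have ig : mu.-integrable A (EFin \o g).
  apply/integrableP; split; first exact/measurable_EFinP.
  by rewrite (le_lt_trans h)// lte_mul_pinfty// lee_fin.
split => //; apply: (le_trans (le_normr_Rintegral mA ig)).
have muA : mu A \is a fin_num by rewrite ge0_fin_numE.
rewrite -lee_fin EFinM (fineK muA); apply: le_trans h.
rewrite /Rintegral fineK//; apply: integrable_fin_num => //.
exact: integrable_norm.
Qed.

(** Hoelder's inequality for [g] and the indicator of [A]. *)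
Lemma L2_integral_le g : measurable_fun Omega g -> (normLp Omega 2%:E g < +oo)%E ->
  mu.-integrable A (EFin \o g) /\
  `|\int[mu]_(x in A) g x| <= fine (normLp Omega 2%:E g) * fine (mu A `^ 2^-1)%E.
Proof.
move=> mg gfin.
have mgO : measurable_fun setT (g \_ Omega) by apply/(measurable_restrictT _ mOmega).
have mgA : measurable_fun A g by exact: measurable_funS mg.
have m1 : measurable_fun setT (\1_A : 'rV[R]_d -> R) by exact: measurable_indic.
have h := @hoelder _ _ _ mu (g \_ Omega) (\1_A) 2 2 mgO m1 (ltr0n _ 2) (ltr0n _ 2)
  (ltac:(by rewrite [RHS](splitr 1) mul1r)).
have N1 : ('N[mu]_1[EFin \o ((g \_ Omega) \* \1_A)%R] =
    \int[mu]_(x in A) `|(g x)%:E|)%E.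
  rewrite Lnorm1 [RHS]integral_mkcond; apply: eq_integral => x _ /=.
  rewrite /patch indicE; case: (boolP (x \in A)) => xA; last by rewrite mulr0 normr0.
  by rewrite mem_set ?mulr1//; apply: AO; exact/set_mem.
have N2 : ('N[mu]_2%:E[EFin \o (\1_A : 'rV[R]_d -> R)] = mu A `^ 2^-1)%E.
  rewrite unlock /Lnorm.body; congr (_ `^ _)%E.
  rewrite -[in RHS](setIT A) -integral_indic//; apply: eq_integral => x _ /=.
  rewrite indicE; case: (x \in A) => /=; first by rewrite normr1 powR1.
  by rewrite normr0 powR0.
rewrite N1 N2 -/(normLp Omega 2%:E g) in h.
have A2fin : (mu A `^ 2^-1 < +oo)%E by rewrite poweR_lty.
have nfin : normLp Omega 2%:E g \is a fin_num by rewrite ge0_fin_numE ?Lnorm_ge0.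
have afin : (mu A `^ 2^-1)%E \is a fin_num by rewrite ge0_fin_numE ?poweR_ge0.
have ig : mu.-integrable A (EFin \o g).
  apply/integrableP; split; first exact/measurable_EFinP.
  by rewrite (le_lt_trans h)// -(fineK nfin) -(fineK afin) -EFinM ltry.
split => //; apply: (le_trans (le_normr_Rintegral mA ig)).
rewrite -lee_fin EFinM (fineK nfin) (fineK afin); apply: le_trans h.
by rewrite /Rintegral fineK//; apply: integrable_fin_num => //; exact: integrable_norm.
Qed.

End finite_measure_subset.

End rV_measure.

Section data_means.
Variables (R : realType) (d : nat) (Omega : set 'rV[R]_d).
Hypotheses (openO : open Omega) (bndO : bounded_set Omega).
Local Notation mu := (lebesgue_rV R d).
Implicit Types (A : set 'rV[R]_d).

Let mO : measurable Omega. Proof. exact: open_measurable_rV. Qed.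

Let sub_fin A : measurable A -> A `<=` Omega -> (mu A < +oo)%E.
Proof.
move=> mA AO; apply: (@le_lt_trans _ _ (mu Omega)).
  by apply: le_measure; rewrite ?inE.
exact: bounded_measure_lt_pinfty.
Qed.

Lemma L2_integral_cvg (f : nat -> 'rV[R]_d -> R) (g : 'rV[R]_d -> R) A :
  measurable A -> A `<=` Omega ->
  (forall k, in_Lp Omega +oo (f k)) -> in_Lp Omega 2%:E g ->
  (fun k => normLp Omega 2%:E (fun x => f k x - g x)) @ \oo --> 0%E ->
  (fun k => \int[mu]_(x in A) f k x) @ \oo --> \int[mu]_(x in A) g x.
Proof.
move=> mA AO fL [mg g2] fg; have Afin := sub_fin mA AO.
have [ig _] := L2_integral_le mO mA AO Afin mg g2.
have iff k : mu.-integrable A (EFin \o f k).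
  have [mfk fk] := fL k.
  have nfin : normLp Omega +oo (f k) \is a fin_num by rewrite ge0_fin_numE ?Lnorm_ge0.
  have [] := @Linfty_integral_le _ _ Omega A mO mA AO Afin (f k)
    (fine (normLp Omega +oo (f k))) (fL k) => //.
  by rewrite fineK.
have /fine_cvgP[fg_fin fg0] := fg.
apply: cvg_of_dist0; apply: (@cvg0_dominated _ _ (fun k =>
  fine (normLp Omega 2%:E (fun x => f k x - g x)) * fine (mu A `^ 2^-1)%E)).
  near=> k.
  have nfin : normLp Omega 2%:E (fun x => f k x - g x) \is a fin_num by near: k.
  rewrite -RintegralB//.
  have [] // := @L2_integral_le _ _ Omega A mO mA AO Afin (fun x => f k x - g x).
  - by apply: measurable_funB => //; have [] := fL k.
  - by rewrite -ge0_fin_numE ?Lnorm_ge0.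
rewrite -(mul0r (fine (mu A `^ 2^-1)%E)); apply: cvgM; last exact: cvg_cst.
exact: fg0.
Unshelve. all: by end_near. Qed.

Section density.
Variables (gamma C : R) (phi : 'rV[R]_d -> R) (eps : nat -> R)
  (rho0 r0 : nat -> 'rV[R]_d -> R) (B : R).
Hypotheses (phi_smooth : smooth_potential Omega phi) (eps_cvg : eps @ \oo --> 0)
  (rho0_L : forall k, in_Lp Omega +oo (rho0 k))
  (r0_L : forall k, in_Lp Omega +oo (r0 k))
  (rho0E : forall k, {ae mu, forall x, Omega x ->
     rho0 k x = rho_tilde gamma phi C x + eps k * r0 k x})
  (r0B : forall k, (normLp Omega +oo (r0 k) <= B%:E)%E).

Let rt := rho_tilde gamma phi C.

Lemma measurable_rho_tilde : measurable_fun Omega rt.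
Proof.
have [V [oV OV] /(_ [::]) phiV] := phi_smooth.
apply: (measurableT_comp (measurable_powR _)).
apply: measurable_funM; first exact: measurable_cst.
apply: measurable_funB; first exact: measurable_cst.
apply: continuous_measurable_rV => // x Ox.
by have [] := phiV x (OV _ (subset_closure Ox)).
Qed.

(** Integrability is inherited from the data, because [rt] coincides almost
    everywhere with the difference of two essentially bounded functions. *)
Lemma rho_tilde_integrable A k : measurable A -> A `<=` Omega ->
  mu.-integrable A (EFin \o rt) /\
  \int[mu]_(x in A) rho0 k x =
    \int[mu]_(x in A) rt x + eps k * \int[mu]_(x in A) r0 k x.
Proof.
move=> mA AO; have Afin := sub_fin mA AO.
have nfin : normLp Omega +oo (rho0 k) \is a fin_num.
  by rewrite ge0_fin_numE ?Lnorm_ge0//; have [] := rho0_L k.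
have [irho _] := @Linfty_integral_le _ _ Omega A mO mA AO Afin (rho0 k)
  (fine (normLp Omega +oo (rho0 k))) (rho0_L k) (ltac:(by rewrite fineK)).
have [ir _] := Linfty_integral_le mO mA AO Afin (r0_L k) (r0B k).
have ier : mu.-integrable A (EFin \o (fun x => eps k * r0 k x)).
  by apply: eq_integrable (integrableZl mA (eps k) ir).
have mrt : measurable_fun A rt.
  by apply: measurable_funS measurable_rho_tilde.
have ae : ae_eq mu A (EFin \o (fun x => rho0 k x - eps k * r0 k x)) (EFin \o rt).
  by apply: filterS (rho0E k) => x /= rx /AO /rx ->; rewrite addrK.
have idiff : mu.-integrable A (EFin \o (fun x => rho0 k x - eps k * r0 k x)).
  by apply: eq_integrable (integrableB mA irho ier).
have /integrableP[mdiff _] := idiff.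
have irt : mu.-integrable A (EFin \o rt).
  apply/integrableP; split; first exact/measurable_EFinP.
  have /integrableP[_] := idiff; rewrite (@ae_eq_integral _ _ _ mu A
    (abse \o (EFin \o rt)))//; first exact: measurableT_comp.
    by apply: measurableT_comp => //; exact/measurable_EFinP.
  by apply: filterS ae => x h Ax; have /= [->] := h Ax.
split => //.
rewrite (_ : \int[mu]_(x in A) rt x =
  \int[mu]_(x in A) (rho0 k x - eps k * r0 k x)); last first.
  congr fine; apply/esym/ae_eq_integral => //.
  exact/measurable_EFinP.
by rewrite RintegralB// RintegralZl// subrK.
Qed.

Lemma density_integral_cvg A : measurable A -> A `<=` Omega ->
  (fun k => \int[mu]_(x in A) rho0 k x) @ \oo --> \int[mu]_(x in A) rt x.
Proof.
move=> mA AO.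
rewrite (_ : (fun _ => _) = (fun k => \int[mu]_(x in A) rt x +
    eps k * \int[mu]_(x in A) r0 k x)); last first.
  by apply/funext => k; have [] := rho_tilde_integrable k mA AO.
rewrite -[X in _ --> X]addr0; apply: cvgD; first exact: cvg_cst.
apply: cvg0_bounded => //; exists (B * fine (mu A)); apply: nearW => k.
by have [] := Linfty_integral_le mO mA AO (sub_fin mA AO) (r0_L k) (r0B k).
Qed.

Lemma rho_tilde_integral_gt0 A (c : R) : measurable A -> A `<=` Omega ->
  0 < c -> (forall x, Omega x -> c <= rt x) -> (0 < mu A)%E ->
  0 < \int[mu]_(x in A) rt x.
Proof.
move=> mA AO c0 crt A0; have Afin := sub_fin mA AO.
have [irt _] := rho_tilde_integrable 0 mA AO.
have muA : mu A \is a fin_num by rewrite ge0_fin_numE.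
apply: (@lt_le_trans _ _ (c * fine (mu A))).
  by rewrite mulr_gt0// fine_gt0// A0.
rewrite -lee_fin EFinM (fineK muA) /Rintegral fineK; last exact: integrable_fin_num.
rewrite -integral_cst//; apply: ge0_le_integral => //.
- by move=> x _; rewrite lee_fin ltW.
- apply/measurable_EFinP.
  by apply: measurable_funS measurable_rho_tilde.
- by move=> x /AO Ox; rewrite lee_fin crt.
Qed.

End density.

End data_means.

Section mean_values.
Variables (R : realType) (d : nat) (Omega : set 'rV[R]_d) (M : mac_grid Omega).
Hypothesis openO : open Omega.
Local Notation mu := (lebesgue_rV R d).

Lemma measurable_cell (K : cell M) : measurable (cbox (cbx K) `&` Omega).
Proof. by apply: measurableI; [exact: measurable_cbox|exact: open_measurable_rV]. Qed.

Lemma measurable_dual_cell (sigma : face M) : measurable (dual_cell sigma `&` Omega).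
Proof.
apply: measurableI; last exact: open_measurable_rV.
apply: countable_bigcupT_measurable => [|s]; first exact: countableP.
by case: cell_at => [K|]; [exact: measurable_cbox|exact: measurable0].
Qed.

Lemma cell_measure_gt0 (K : cell M) : (0 < mu (cbox (cbx K) `&` Omega))%E.
Proof.
have [x [Ox Kx]] := meets_domain K.
have oI : open (Omega `&` obox (cbx K)) by apply: openI => //; exact: open_obox.
apply: (lt_le_trans (open_measure_gt0 oI (conj Ox Kx))).
apply: le_measure; rewrite ?inE; [exact: open_measurable_rV|exact: measurable_cell|].
by move=> y [Oy Ky]; split => // j; have /andP[/ltW-> /ltW->] := Ky j.
Qed.

End mean_values.

(** * Norms *)

Section norms.
Variable R : realType.

(** With a predicate [P], so as to cover norms that are only required to behave
    on the fields that vanish on external faces. *)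
Lemma norm_le_sum (I : finType) (P : pred I) (nrm : {ffun I -> R} -> R)
    (supp := fun v : {ffun I -> R} => forall i, ~~ P i -> v i = 0) :
  (forall v w, supp v -> supp w -> nrm (v + w) <= nrm v + nrm w) ->
  (forall a v, supp v -> nrm [ffun i => a * v i] = `|a| * nrm v) ->
  forall v, supp v ->
    `|nrm v| <= \sum_(i | P i) `|v i| * nrm [ffun j => (j == i)%:R].
Proof.
move=> nrmD nrmM.
have supp0 : supp 0 by move=> i _; rewrite ffunE.
have nrm0 : nrm 0 = 0.
  have -> : 0 = [ffun i => 0 * (0 : {ffun I -> R}) i] :> {ffun I -> R}.
    by apply/ffunP => i; rewrite !ffunE mul0r.
  by rewrite nrmM// normr0 mul0r.
have nrm_ge0 v : supp v -> 0 <= nrm v.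
  move=> vs; have sN : supp [ffun i => -1 * v i].
    by move=> i /vs vi; rewrite ffunE vi mulr0.
  have := nrmD _ _ vs sN; rewrite (nrmM _ _ vs) normrN1 mul1r.
  rewrite (_ : v + _ = 0) ?nrm0; first by lra.
  by apply/ffunP => i; rewrite !ffunE; ring.
have supp1 i : P i -> supp [ffun j => (j == i)%:R].
  by move=> Pi j Pj; rewrite ffunE; case: eqP => // ji; rewrite ji Pi in Pj.
move=> v vs; rewrite ger0_norm ?nrm_ge0//.
have {1}-> : v = \sum_(i | P i) [ffun j => v i * [ffun j => (j == i)%:R] j].
  apply/ffunP => j; rewrite sum_ffunE.
  have [Pj|/[dup] Pj /vs->] := boolP (P j).
    rewrite (bigD1 j)//= !ffunE eqxx mulr1 big1 ?addr0// => i /andP[_ ij].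
    by rewrite !ffunE eq_sym (negbTE ij) mulr0.
  rewrite big1// => i Pi; rewrite !ffunE; case: eqP => [ji|_]; last by rewrite mulr0.
  by rewrite ji Pi in Pj.
have : supp (\sum_(i | P i) [ffun j => v i * [ffun j => (j == i)%:R] j]) /\
  nrm (\sum_(i | P i) [ffun j => v i * [ffun j => (j == i)%:R] j]) <=
  \sum_(i | P i) `|v i| * nrm [ffun j => (j == i)%:R]; last by case.
elim/big_ind2 : _ => [|x1 x2 y1 y2 [s1 h1] [s2 h2]|i Pi]; first by rewrite nrm0.
- split; first by move=> i Pi; rewrite ffunE s1// s2// addr0.
  by rewrite (le_trans (nrmD _ _ s1 s2))// lerD.
- split; last by rewrite nrmM//; exact: supp1.
  by move=> j /(supp1 i Pi) e; rewrite ffunE e mulr0.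
Qed.

Lemma normLinfty_time_cvg (T : R) (g : nat -> R -> \bar R) (b : nat -> R) :
  (forall k, 0 <= b k) ->
  (forall k t, 0 < t < T -> (`|g k t| <= (b k)%:E)%E) ->
  b @ \oo --> 0 -> (fun k => normLinfty_time T (g k)) @ \oo --> 0%E.
Proof.
move=> b0 gb bcvg.
apply: (@squeeze_cvge _ _ _ _ (fun=> 0%E) _ (fun k => (b k)%:E)).
- apply: nearW => k; rewrite Lnorm_ge0/= /normLinfty_time unlock /Lnorm.body.
  case: ifP => _; last by rewrite lee_fin.
  apply/ess_supP; apply: nearW => t /=; rewrite /patch.
  by case: ifPn => [/set_mem/= /[!in_itv]/= /gb//|_]; rewrite abse0 lee_fin.
- exact: cvg_cst.
- by apply/fine_cvgP; split => //; exact: nearW.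
Qed.

Lemma in_time_level (V : Type) (dt T t : R) (N : nat) :
  0 < dt -> N%:R * dt = T -> 0 < t < T ->
  exists2 n, (n < N)%N & forall w : nat -> V, in_time dt w t = w n.+1.
Proof.
move=> dt0 NT /andP[t0 tT].
have c0 : (0 < Num.ceil (t / dt))%R by rewrite ceil_gt0 divr_gt0.
have cN : (Num.ceil (t / dt) <= N%:Z)%R.
  by rewrite ceil_le_int -pmulrn ler_pdivrMr// NT ltW.
move: c0 cN; rewrite /in_time; case: (Num.ceil (t / dt)) => // -[//|n] _ nN.
by exists n.
Qed.

(** The difference is bounded by the sum of its cell values on [Omega], and
    [Omega] has finite measure. *)
Lemma normLp_cfun_val_le (d : nat) (Omega : set 'rV[R]_d) (M : mac_grid Omega)
    (r : R) : open Omega -> bounded_set Omega -> 0 < r ->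
  exists2 c : R, 0 <= c & forall p q : cfun M,
    (normLp Omega r%:E (fun x => (cfun_val p x - cfun_val q x)%R) <=
      (c * \sum_K `|p K - q K|)%:E)%E.
Proof.
move=> oO bO r0; have mO := open_measurable_rV oO.
have Ofin := bounded_measure_lt_pinfty mO bO.
have mufin : lebesgue_rV R d Omega \is a fin_num by rewrite ge0_fin_numE.
set m := fine (lebesgue_rV R d Omega).
have m0 : 0 <= m by exact: fine_ge0.
exists (m `^ r^-1); first exact: powR_ge0.
move=> p q; set B := \sum_K _; have B0 : 0 <= B by exact: sumr_ge0.
have fB x : `|cfun_val p x - cfun_val q x| <= B.
  rewrite /cfun_val -sumrB (le_trans (ler_norm_sum _ _ _))//.
  apply: ler_sum => K _; rewrite -mulrBl normrM ler_piMr//.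
  by rewrite indicE; case: (_ \in _); rewrite ?normr1 ?normr0.
have mval (s : cfun M) : measurable_fun setT (cfun_val s).
  apply: measurable_sum => K; apply: measurable_funM; first exact: measurable_cst.
  by apply: measurable_indic; exact: measurable_cbox.
set f := (X in normLp _ _ X).
have mf : measurable_fun setT (f \_ Omega).
  apply/(measurable_restrictT _ mO); apply: (measurable_funS measurableT) => //.
  exact: measurable_funB.
have h : (\int[lebesgue_rV R d]_x (`|(EFin \o (f \_ Omega)) x| `^ r) <=
    (B `^ r)%:E * m%:E)%E.
  have -> : (m%:E = \int[lebesgue_rV R d]_x (\1_Omega x)%:E)%E.
    by rewrite integral_indic// setIT fineK.
  rewrite -ge0_integralZl//.
  - apply: ge0_le_integral => //.
    + by move=> x _; exact: poweR_ge0.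
    + apply: (@measurableT_comp _ _ _ _ _ _ (fun y => y `^ r)%E) => //.
        exact: measurable_poweR.
      by apply: measurableT_comp => //; apply/measurable_EFinP; exact: mf.
    + apply: measurable_funeM; apply/measurable_EFinP; exact: measurable_indic.
    + move=> x _; rewrite /= /patch indicE.
      case: (x \in Omega).
        by rewrite mule1 lee_fin ge0_ler_powR ?nnegrE ?(ltW r0)//; exact: fB.
      by rewrite normr0 powR0 ?gt_eqF// mule0.
  - by apply/measurable_EFinP; exact: measurable_indic.
  - by rewrite lee_fin powR_ge0.
rewrite /normLp unlock /Lnorm.body.
apply: (le_trans (gt0_ler_poweR _ _ _ h)).
- by rewrite invr_ge0 ltW.
- by rewrite in_itv/= leey andbT integral_ge0// => x _; exact: poweR_ge0.
- by rewrite in_itv/= leey andbT mule_ge0// lee_fin powR_ge0.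
rewrite -EFinM poweR_EFin lee_fin powRM ?powR_ge0// -powRrM divff ?gt_eqF// powRr1//.
by rewrite mulrC.
Qed.

End norms.

(** * The limit scheme *)

Theorem theorem7p6 (R : realType) (d : nat) (hd : (1 <= d <= 3)%N)
  (T gamma : R) (hT : 0 < T) (hgamma : 1 < gamma)
  (Omega : set 'rV[R]_d) (hOmega : is_domain Omega)
  (phi : 'rV[R]_d -> R) (hphi : smooth_potential Omega phi)
  (m0 C : R) (hC : hydrostatic Omega gamma phi m0 C)
  (M : mac_grid Omega) (N : nat) (dt : R) (hdt : 0 < dt) (hN : N%:R * dt = T)
  (eta1 : R) (heta1 : 3 / 2 < eta1)
  (eps : nat -> R) (heps : forall k, 0 < eps k) (heps0 : eps @ \oo --> 0)
  (rho0 : nat -> 'rV[R]_d -> R) (u0 : nat -> 'rV[R]_d -> 'rV[R]_d)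
  (U0 : 'rV[R]_d -> 'rV[R]_d)
  (hwell : well_prepared Omega gamma phi C eps rho0 u0 U0)
  (rho : nat -> nat -> cfun M) (u : nat -> nat -> ffield M)
  (hsol : forall k, numerical_solution gamma dt N (eps k) eta1
            (phi_M M gamma phi C) (rho0 k) (u0 k) (rho k) (u k))
  (hstab : forall k n, (n < N)%N ->
            stability gamma dt (eps k) eta1 (phi_M M gamma phi C)
              (rho k n) (rho k n.+1) (u k n)) :
  let rhot := rho_tilde_M M gamma phi C in
  (forall r : R, 1 < r <= Num.min 2 gamma ->
     (fun k => normLinfty_time T (fun t =>
        normLp Omega r%:E
          (fun x => cfun_val (in_time dt (rho k) t) x - cfun_val rhot x)))
       @ \oo --> 0%E) /\
  (forall nrm : cfun M -> R, is_cfun_norm nrm ->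
     (fun k => normLinfty_time T (fun t =>
        (nrm (in_time dt (rho k) t - rhot))%:E)) @ \oo --> 0%E) /\
  exists (pi : nat -> cfun M) (U : nat -> ffield M) (eta : nat -> face M -> R),
    [/\ forall n, (n <= N)%N -> H0 (U n),
        forall nrm : ffield M -> R, is_H0_norm nrm ->
          (fun k => normLinfty_time T (fun t =>
             (nrm (in_time dt (u k) t - in_time dt U t))%:E)) @ \oo --> 0%E,
        forall sigma, (fun k => u k 0%N sigma) @ \oo --> U 0%N sigma,
        forall n sigma, (n < N)%N -> internal sigma ->
          (fun k => eta_stab eta1 (rho k n) sigma) @ \oo --> eta n sigma /\
          (dual_avg rhot sigma)^-1 < eta n sigma &
        forall n, (n < N)%N ->
          limit_step gamma dt (eta n) rhot (pi n.+1) (U n) (U n.+1)].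
Proof.
have [openO connO bndO _] := hOmega.
have [_ [c c0 crt] _] := hC.
have [rho0_u0_L _ [r0 [r0P [B r0B] _]] U0P _] := hwell.
have eta1_gt1 : 1 < eta1 by rewrite (lt_trans _ heta1)// ltr_pdivlMr// mul1r ltr_nat.
have eta1_gt0 : 0 < eta1 by exact: lt_trans eta1_gt1.
move=> rhot.
have rho0_L k : in_Lp Omega +oo (rho0 k) by have [] := rho0_u0_L k.
have r0_L k : in_Lp Omega +oo (r0 k) by have [] := r0P k.
have rho0E k : {ae lebesgue_rV R d, forall x, Omega x ->
    rho0 k x = rho_tilde gamma phi C x + eps k * r0 k x} by have [] := r0P k.
(* A cell mean of a function bounded below on the part of the cell in [Omega],
   which has positive measure. *)
have rhot_gt0 K : 0 < rhot K.
  rewrite /rhot ffunE mulr_gt0 ?invr_gt0 ?volume_gt0//.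
  apply: (@rho_tilde_integral_gt0 _ _ Omega openO bndO gamma C phi eps rho0 r0 B
    hphi rho0_L r0_L rho0E r0B _ c) => //.
  - exact: measurable_cell.
  - exact: cell_measure_gt0.
have init_density K : (fun k => rho k 0%N K) @ \oo --> rhot K.
  rewrite (_ : (fun _ => _) = (fun k => (volume (cbx K))^-1 *
      \int[lebesgue_rV R d]_(x in cbox (cbx K) `&` Omega) rho0 k x)).
    rewrite /rhot ffunE; apply: cvgM; first exact: cvg_cst.
    apply: (density_integral_cvg openO bndO hphi heps0 rho0_L r0_L rho0E r0B) => //.
    exact: measurable_cell.
  by apply/funext => k; have [-> _ _] := hsol k; rewrite ffunE.
have init_velocity sigma : exists Us : R, (fun k => u k 0%N sigma) @ \oo --> Us.
  exists (face_mean M U0 sigma).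
  rewrite (_ : (fun _ => _) = (fun k => face_mean M (u0 k) sigma)); last first.
    by apply/funext => k; have [_ -> _] := hsol k.
  rewrite /face_mean ffunE; under eq_fun do rewrite ffunE.
  case: ifP => _; last exact: cvg_cst.
  apply: cvgM; first exact: cvg_cst.
  have [U0L u0U0] := U0P (dir sigma).
  apply: (L2_integral_cvg openO bndO) => //; first exact: measurable_dual_cell.
  by move=> k; have [_] := rho0_u0_L k; exact.
have ratio n (nN : (n < N)%N) k sigma : internal sigma ->
    dual_avg (rho k n) sigma / dual_avg (rho k n.+1) sigma <= 3 / 2.
  by move=> hs; have [] := hstab k n nN sigma hs.
have nextP n (nN : (n < N)%N) k := let: And3 _ _ h := hsol k in h n nN.
have u_H0 n k : (n <= N)%N -> H0 (u k n).
  case: n => [_ sigma hs|n nN]; last by have [] := nextP n nN k.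
  by have [_ -> _] := hsol k; rewrite ffunE (negbTE hs).
have all_levels n : (n <= N)%N -> (forall K, (fun k => rho k n K) @ \oo --> rhot K) /\
    forall sigma, exists Us : R, (fun k => u k n sigma) @ \oo --> Us.
  elim: n => [|n IH] nN; first by split.
  have [rho_cvg /fin_all_exists[W Wcvg]] := IH (ltnW nN).
  have Wcvg' sigma : (fun k => u k n sigma) @ \oo --> [ffun s => W s] sigma.
    by rewrite ffunE; exact: Wcvg.
  have r1_gt0 k K : 0 < rho k n.+1 K by have [_ + _] := nextP n nN k; exact.
  have step k : scheme_step gamma dt (eps k) eta1 (phi_M M gamma phi C) (rho k n)
      (rho k n.+1) (u k n) (u k n.+1) by have [] := nextP n nN k.
  have u1_H0 k := u_H0 n.+1 k nN.
  split.
    exact: (next_density_cvg openO connO hgamma hdt eta1_gt0 heps heps0 rhot_gt0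
      rho_cvg Wcvg' r1_gt0 step (ratio n nN)).
  have [p [W1 [_ W1cvg]]] := limit_of_step openO connO hgamma hdt eta1_gt0 heps heps0
    rhot_gt0 rho_cvg Wcvg' r1_gt0 step (ratio n nN) u1_H0.
  by move=> sigma; exists (W1 sigma).
have rho_cvg n nN := (all_levels n nN).1.
(* The limits exist at each level, so they may be named before the limit scheme
   is established; uniqueness of limits identifies them with those of
   [limit_of_step]. *)
pose U n : ffield M := [ffun sigma => lim ((fun k => u k n sigma) @ \oo)].
have U_cvg n : (n <= N)%N -> forall sigma, (fun k => u k n sigma) @ \oo --> U n sigma.
  move=> nN sigma; rewrite ffunE; have [Us h] := (all_levels n nN).2 sigma.
  by apply/cvg_ex; exists Us.
have U_H0 n : (n <= N)%N -> H0 (U n).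
  move=> nN sigma hs; rewrite ffunE.
  rewrite (_ : (fun _ => _) = cst 0); first exact: lim_cst.
  by apply/funext => k; exact: u_H0.
have pressure n : exists p : cfun M, (n < N)%N -> limit_step gamma dt
    (fun sigma => eta1 / dual_avg rhot sigma) rhot p (U n) (U n.+1).
  case: (ltnP n N) => [nN|_]; last by exists 0.
  have r1_gt0 k K : 0 < rho k n.+1 K by have [_ + _] := nextP n nN k; exact.
  have step k : scheme_step gamma dt (eps k) eta1 (phi_M M gamma phi C) (rho k n)
      (rho k n.+1) (u k n) (u k n.+1) by have [] := nextP n nN k.
  have u1_H0 k := u_H0 n.+1 k nN.
  have [p [W1 [lim_p W1cvg]]] := limit_of_step openO connO hgamma hdt eta1_gt0 heps heps0
    rhot_gt0 (rho_cvg n (ltnW nN)) (U_cvg n (ltnW nN)) r1_gt0 step (ratio n nN) u1_H0.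
  exists p => _; rewrite (_ : U n.+1 = W1)//; apply/ffunP => sigma.
  exact: (cvg_unique _ (U_cvg n.+1 nN sigma) (W1cvg sigma)).
(* [p n] is the pressure of the step from level [n], hence of level [n.+1]. *)
have /choice[p pP] := pressure.
have total_cvg n : (n < N)%N ->
    (fun k => \sum_K `|rho k n.+1 K - rhot K|) @ \oo --> 0.
  move=> nN; apply: cvg_bigsum0 => K _; apply/norm_cvg0P; apply: dist0_of_cvg.
  exact: rho_cvg.
split; [|split].
- move=> r /andP[r1 _]; have r_gt0 : 0 < r by exact: lt_trans r1.
  have [c' c'0 c'P] := normLp_cfun_val_le M openO bndO r_gt0.
  (* The supremum over the time levels is bounded by the sum over them. *)
  apply: (@normLinfty_time_cvg _ _ _ (fun k => \sum_(n < N)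
      c' * \sum_K `|rho k n.+1 K - rhot K|)).
  + by move=> k; apply: sumr_ge0 => n _; rewrite mulr_ge0// sumr_ge0.
  + move=> k t tT; have [n nN ->] := in_time_level (cfun M) hdt hN tT.
    rewrite gee0_abs ?Lnorm_ge0//; apply: (le_trans (c'P _ _)).
    rewrite lee_fin (bigD1 (Ordinal nN))//= lerDl.
    by apply: sumr_ge0 => i _; rewrite mulr_ge0// sumr_ge0.
  + apply: cvg_bigsum0 => n _; rewrite -[X in _ --> X](mulr0 c'); apply: cvgM; first exact: cvg_cst.
    exact: (total_cvg n (ltn_ord n)).
- move=> nrm [_ nrmD nrmM].
  have nrm_le q : `|nrm q| <=
      \sum_K `|q K| * nrm [ffun L => (L == K)%:R].
    by apply: (@norm_le_sum _ _ predT) => // *; exact: nrmM.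
  apply: (@normLinfty_time_cvg _ _ _ (fun k => \sum_(n < N)
      \sum_K `|(rho k n.+1 - rhot) K| * nrm [ffun L => (L == K)%:R])).
  + by move=> k; apply: sumr_ge0 => n _; exact: le_trans (nrm_le _).
  + move=> k t tT; have [n nN ->] := in_time_level (cfun M) hdt hN tT.
    rewrite lee_fin (le_trans (nrm_le _))// (bigD1 (Ordinal nN))//= lerDl.
    by apply: sumr_ge0 => i _; exact: le_trans (nrm_le _).
  + apply: cvg_bigsum0 => n _; apply: cvg_bigsum0 => K _.
    rewrite -[X in _ --> X](mul0r (nrm [ffun L => (L == K)%:R])); apply: cvgM; last exact: cvg_cst.
    apply/norm_cvg0P; under eq_fun do rewrite cfunB; apply: dist0_of_cvg.
    by apply: rho_cvg; exact: ltn_ord.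
exists (fun n => p n.-1), U, (fun _ sigma => eta1 / dual_avg rhot sigma); split.
- exact: U_H0.
- move=> nrm [_ nrmD nrmM].
  have nrm_le v : H0 v -> `|nrm v| <= \sum_(sigma | internal sigma)
      `|v sigma| * nrm [ffun sigma' => (sigma' == sigma)%:R].
    by move=> v0; apply: (@norm_le_sum _ _ (@internal _ _ _ M)) => //.
  have dist_H0 k n : (n < N)%N -> H0 (u k n.+1 - U n.+1).
    move=> nN sigma hs; rewrite !ffunE.
    by rewrite (u_H0 n.+1 k nN)//; have := U_H0 n.+1 nN sigma hs; rewrite ffunE => ->; rewrite subr0.
  apply: (@normLinfty_time_cvg _ _ _ (fun k => \sum_(n < N)
      \sum_(sigma | internal sigma) `|(u k n.+1 - U n.+1) sigma| *
        nrm [ffun sigma' => (sigma' == sigma)%:R])).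
  + by move=> k; apply: sumr_ge0 => n _; exact: le_trans (nrm_le _ (dist_H0 _ _ _)).
  + move=> k t tT; have [n nN lev] := in_time_level (ffield M) hdt hN tT.
    rewrite !lev lee_fin (le_trans (nrm_le _ (dist_H0 _ _ nN)))//.
    rewrite (bigD1 (Ordinal nN))//= lerDl.
    by apply: sumr_ge0 => i _; exact: le_trans (nrm_le _ (dist_H0 _ _ _)).
  + apply: cvg_bigsum0 => n _; apply: cvg_bigsum0 => sigma _.
    rewrite -[X in _ --> X](mul0r (nrm [ffun s => (s == sigma)%:R])); apply: cvgM; last exact: cvg_cst.
    apply/norm_cvg0P.
    rewrite (_ : (fun _ => _) = (fun k => u k n.+1 sigma - U n.+1 sigma)).
      by apply: dist0_of_cvg; apply: U_cvg; exact: ltn_ord.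
    by apply/funext => k; rewrite [LHS]ffunE [X in _ + X]ffunE.
- by move=> sigma; exact: U_cvg.
- move=> n sigma nN hs; have d0 := dual_avg_gt0 rhot_gt0 hs; split.
    apply: cvgM; first exact: cvg_cst.
    apply: cvgV; first by rewrite gt_eqF.
    by apply: dual_avg_cvg; exact: rho_cvg (ltnW nN).
  by rewrite ltr_pMl ?invr_gt0.
- by move=> n nN; exact: pP.
Qed.
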